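(* Let $d\ge1$, $\gamma>1$, $\beta\in\mathbb{R}$, and for $\xi\in\mathbb{R}^d$ let $$L(\xi)=\tfrac12\log(e^2+|\xi|^2),\qquad m_{\gamma,\beta}(\xi)=L(\xi)^{-\beta}e^{iL(\xi)^\gamma}.$$ Then, in the high-frequency region $|\xi|\ge R_0$, for every multi-index $\nu$ there is a constant $C_{\nu,\gamma,\beta}$ such that $$|D^\nu m_{\gamma,\beta}(\xi)|\le C_{\nu,\gamma,\beta}(\log|\xi|)^{-\beta}\left(\frac{(\log|\xi|)^{\gamma-1}}{|\xi|}\right)^{|\nu|}.$$ Consequently, $m_{\gamma,\beta}$ satisfies the localized logarithmic Miyachi condition of order $(\gamma,\beta,\sigma)$ (defined in the context) for every finite Sobolev order $\sigma>d/2$.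
   Context: Scales: $R_0\ge e^2$ is a fixed number, chosen sufficiently large depending on the structural constants. For $R\ge R_0$ put $\rho(R)=R/(\log R)^{\gamma-1}$. Log-subdyadic balls: for a Euclidean ball $B\subset\mathbb{R}^d$ with radius $r(B)$ let $R_B=\operatorname{dist}(B,0)$. $B$ is log-subdyadic if $R_B\ge R_0$ and $c_0\rho(R_B)\le r(B)\le C_0\rho(R_B)$, with fixed structural constants $0<c_0<C_0<\infty$. Adapted bumps: let $N$ be a fixed integer, sufficiently large compared with the Sobolev exponent $\sigma$ used. A normalized bump adapted to $B$ is $\Psi_B\in C_c^\infty(\mathbb{R}^d)$ with $\operatorname{supp}\Psi_B\subset C_1B$ (fixed dilation constant $C_1$) and $|D^\nu\Psi_B|\le C_\nu r(B)^{-|\nu|}$ for $|\nu|\le N$, with fixed constants $C_\nu$. Localized logarithmic Miyachi condition of order $(\gamma,\beta,\sigma)$, $\sigma>d/2$, for a symbol $m$: there is a constant $C_m$ such that for every log-subdyadic ball $B$, every adapted normalized bump $\Psi_B$ and every $0\le\theta\le\sigma$, $$(\log R_B)^\beta\rho(R_B)^\theta|B|^{-1/2}\|m\Psi_B\|_{\dot H^\theta}\le C_m.$$ *)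

(* Defs.v *)
From HB Require Import structures.
From mathcomp Require Import all_boot all_order all_algebra.
From mathcomp Require Import all_classical all_reals all_analysis.
From mathcomp Require Import complex.

Set Implicit Arguments.
Unset Strict Implicit.
Unset Printing Implicit Defensive.

Import Order.TTheory GRing.Theory Num.Theory.
Import numFieldNormedType.Exports.

Local Open Scope classical_set_scope.
Local Open Scope ring_scope.

(** Lebesgue measure on the Borel sets of R^d (as d-tuples): the d-fold product
    of one-dimensional Lebesgue measure. *)

Section lebesgue_tuple_step.
Context {R : realType} (n : nat).
Variable mu : {sigma_finite_measure set (n.-tuple (measurableTypeR R)) -> \bar R}.

Definition tuple_of_prod (p : measurableTypeR R * n.-tuple (measurableTypeR R)) :
  n.+1.-tuple (measurableTypeR R) := [the n.+1.-tuple _ of p.1 :: p.2].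

Lemma measurable_tuple_of_prod : measurable_fun [set: _] tuple_of_prod.
Proof. exact: measurable_cons. Qed.

Definition lebesgue_cons : set (n.+1.-tuple (measurableTypeR R)) -> \bar R :=
  pushforward (@lebesgue_measure R \x mu)%E tuple_of_prod.

Let lebesgue_cons0 : lebesgue_cons set0 = 0%E.
Proof. by rewrite /lebesgue_cons /pushforward preimage_set0 measure0. Qed.

Let lebesgue_cons_ge0 A : (0 <= lebesgue_cons A)%E.
Proof. exact: (measure_ge0 (lebesgue_measure \x mu)%E). Qed.

Let lebesgue_cons_sigma_additive : semi_sigma_additive lebesgue_cons.
Proof.
move=> F mF tF mUF; rewrite /lebesgue_cons /pushforward preimage_bigcup.
have mpre A : measurable A -> measurable (tuple_of_prod @^-1` A).
  by move=> mA; rewrite -[X in measurable X]setTI;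
     exact: measurable_tuple_of_prod.
apply: measure_semi_sigma_additive.
- by move=> k; exact: mpre.
- apply/trivIsetP => /= i j _ _ ij; rewrite -preimage_setI.
  by move/trivIsetP : tF => /(_ _ _ _ _ ij) ->//; rewrite preimage_set0.
- by rewrite -preimage_bigcup; exact: mpre.
Qed.

HB.instance Definition _ := isMeasure.Build _ _ _ lebesgue_cons
  lebesgue_cons0 lebesgue_cons_ge0 lebesgue_cons_sigma_additive.

Let lebesgue_cons_sigma_finite : sigma_finite setT lebesgue_cons.
Proof.
have /sigma_finiteP[F [FT Fnd Foo]] := sigma_finiteT (@lebesgue_measure R).
have /sigma_finiteP[G [GT Gnd Goo]] := sigma_finiteT mu.
pose split (t : n.+1.-tuple (measurableTypeR R)) :=
  (thead t, [tuple of behead t] : n.-tuple (measurableTypeR R)).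
have splitK p : split (tuple_of_prod p) = p.
  by case: p => x t; congr (_, _); apply: val_inj.
exists (fun k => split @^-1` (F k `*` G k)).
  apply/esym; rewrite -subTset => t _.
  have [i _ Fi] : (\bigcup_i F i) (split t).1 by rewrite -FT.
  have [j _ Gj] : (\bigcup_i G i) (split t).2 by rewrite -GT.
  exists (maxn i j) => //; split.
    by move: Fi; apply/subsetPset/Fnd/leq_maxl.
  by move: Gj; apply/subsetPset/Gnd/leq_maxr.
move=> k; have [mF Fk] := Foo k; have [mG Gk] := Goo k; split.
  rewrite -[X in measurable X]setTI.
  suff msplit : measurable_fun [set: _] split.
    by apply: msplit => //; exact: measurableX.
  apply/measurable_fun_pair => /=; last exact: measurable_behead.
  exact: measurable_tnth.
rewrite /lebesgue_cons /pushforward -comp_preimage.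
rewrite (_ : split \o tuple_of_prod = id) ?preimage_id; last exact/funext.
by rewrite [ltLHS]product_measure1E// lte_mul_pinfty// ge0_fin_numE.
Qed.

HB.instance Definition _ := @Measure_isSigmaFinite.Build _ _ _
  lebesgue_cons lebesgue_cons_sigma_finite.

End lebesgue_tuple_step.

Fixpoint lebesgue_tuple (R : realType) (d : nat) :
    {sigma_finite_measure set (d.-tuple (measurableTypeR R)) -> \bar R} :=
  match d with
  | 0 => \d_ ([tuple] : 0.-tuple (measurableTypeR R))
  | n.+1 => lebesgue_cons (lebesgue_tuple R n)
  end.

Section euclidean_space.
Context {R : realType} {d : nat}.
Implicit Types (x y c : 'rV[R]_d) (A : set 'rV[R]_d).

Definition of_tuple (t : d.-tuple (measurableTypeR R)) : 'rV[R]_d :=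
  \row_i tnth t i.

Definition dotp x y : R := \sum_i x 0 i * y 0 i.

(* The library norm on 'rV[R]_d is the sup norm. *)
Definition enorm x : R := Num.sqrt (dotp x x).

Definition eball c (r : R) : set 'rV[R]_d := [set x | enorm (x - c) < r].

Definition dist0 A : R := inf (enorm @` A).

Definition vol A : \bar R := lebesgue_tuple R d (of_tuple @^-1` A).

End euclidean_space.

(** Calculus of functions R^d -> C, through real and imaginary parts. *)

Section calculus.
Context {R : realType} {d : nat}.
Implicit Types (f g : 'rV[R]_d -> R[i]) (nu : {ffun 'I_d -> nat}).

Definition re f : 'rV[R]_d -> R := fun x => complex.Re (f x).
Definition im f : 'rV[R]_d -> R := fun x => complex.Im (f x).

Definition partial (i : 'I_d) f : 'rV[R]_d -> R[i] :=
  fun x => Complex ('D_(delta_mx 0 i) (re f) x) ('D_(delta_mx 0 i) (im f) x).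

Definition partials (s : seq 'I_d) f : 'rV[R]_d -> R[i] := foldr partial f s.

Definition mlen nu : nat := (\sum_i nu i)%N.

Definition mderiv nu f : 'rV[R]_d -> R[i] :=
  partials (flatten [seq nseq (nu i) i | i <- enum 'I_d]) f.

(* All iterated partial derivatives exist and are continuous. The operator 'D_v
   is total, hence the explicit derivability clause. *)
Definition smooth f : Prop := forall s : seq 'I_d,
  [/\ continuous (re (partials s f)),
      continuous (im (partials s f)) &
      forall (i : 'I_d) (x : 'rV[R]_d),
        derivable (re (partials s f)) x (delta_mx 0 i) /\
        derivable (im (partials s f)) x (delta_mx 0 i)].

Definition supp f : set 'rV[R]_d := closure [set x | f x != 0].

Definition cabs (z : R[i]) : R := ComplexField.Normc.normc z.

Definition cis (t : R) : R[i] := Complex (cos t) (sin t).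

Definition cintegral f : R[i] :=
  Complex (\int[lebesgue_tuple R d]_t re f (of_tuple t))
          (\int[lebesgue_tuple R d]_t im f (of_tuple t)).

Definition fourier f (xi : 'rV[R]_d) : R[i] :=
  cintegral (fun x => f x * cis (- (2 * pi * dotp x xi))).

(* ||f||_{\dot H^theta} = ||(-Delta)^{theta/2} f||_{L^2}; the weight 2 pi matches
   the normalization of [fourier], so that theta = 0 gives the L^2 norm. *)
Definition Hdot_norm (theta : R) f : \bar R :=
  ((\int[lebesgue_tuple R d]_t
     ((2 * pi * enorm (of_tuple t)) `^ (2 * theta) *
      cabs (fourier f (of_tuple t)) ^+ 2)%R%:E) `^ 2^-1%R)%E.

End calculus.

Section miyachi.
Context {R : realType} {d : nat}.
Implicit Types (c : 'rV[R]_d) (m Psi : 'rV[R]_d -> R[i]).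

Definition rho (gamma r : R) : R := r / ln r `^ (gamma - 1).

Definition log_subdyadic (gamma R0 c0 C0 : R) c (r : R) : Prop :=
  let RB := dist0 (eball c r) in
  [/\ 0 < r, R0 <= RB, c0 * rho gamma RB <= r & r <= C0 * rho gamma RB].

Definition adapted_bump (C1 : R) (N : nat) (Cnu : {ffun 'I_d -> nat} -> R)
    c (r : R) Psi : Prop :=
  [/\ smooth Psi, compact (supp Psi), supp Psi `<=` eball c (C1 * r) &
      forall nu : {ffun 'I_d -> nat}, (mlen nu <= N)%N -> forall x,
        cabs (mderiv nu Psi x) <= Cnu nu * r ^- mlen nu].

Definition miyachi (R0 c0 C0 C1 : R) (N : nat) (Cnu : {ffun 'I_d -> nat} -> R)
    (gamma beta sigma : R) m : Prop :=
  exists Cm : R, forall c (r : R) Psi (theta : R),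
    log_subdyadic gamma R0 c0 C0 c r ->
    adapted_bump C1 N Cnu c r Psi ->
    0 <= theta <= sigma ->
    let RB := dist0 (eball c r) in
    (((ln RB `^ beta * rho gamma RB `^ theta)%R)%:E *
     vol (eball c r) `^ (- 2^-1)%R *
     Hdot_norm theta (fun x => (m x * Psi x)%R) <= Cm%:E)%E.

Definition L (xi : 'rV[R]_d) : R := 2^-1 * ln (expR 2 + enorm xi ^+ 2).

Definition msym (gamma beta : R) (xi : 'rV[R]_d) : R[i] :=
  Complex (L xi `^ (- beta)) 0 * cis (L xi `^ gamma).

End miyachi.

(* Main.v *)
(** The functions x_j / Q and 1 / Q, where Q = e^2 + |x|^2, the powers of L, and
    cos (L^gamma), sin (L^gamma) lie in symbol classes closed under products, in which
    each derivative costs one factor (log |x|)^(gamma - 1) / |x|; this is a simultaneous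
    induction on the order, as the derivatives of these functions are products of the
    same functions.

    The Miyachi condition then needs no Plancherel theorem, because the bounds on the
    bumps cover many more than sigma derivatives.  On the support of a bump adapted
    to B one has |x| ~ R_B, so the pure derivatives of m Psi of order k are
    O((log R_B)^(- beta) rho^(- k)).  Integrating by parts K times in one coordinate,
    |F(m Psi)(xi)| <= C (log R_B)^(- beta) rho^d min(1, min_j (rho |xi_j|)^(- K)).
    With K = n + d and n >= sigma, the integrand of the Sobolev norm is therefore
    dominated by a product of Cauchy kernels 1 / (1 + (2 pi rho xi_j)^2), whose integral
    over R^d is (2 rho)^(- d); this is the scaling required by the condition. *)

Require Import Defs.
From mathcomp Require Import all_boot all_order all_algebra.
From mathcomp Require Import all_classical all_reals all_analysis.
From mathcomp Require Import complex measurable_realfun ring lra.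

Set Implicit Arguments.
Unset Strict Implicit.
Unset Printing Implicit Defensive.

Import Order.TTheory GRing.Theory Num.Theory.
Import numFieldNormedType.Exports.

Local Open Scope classical_set_scope.
Local Open Scope ring_scope.

(** A class prescribes sizes only on the sets [D], while continuity and derivability are required on
    the whole space: the estimates concern high frequencies, whereas smoothness and integration by
    parts concern all of R^d.

    The set [J] of admissible directions is there for the bumps. Their hypothesis bounds [mderiv],
    which takes partial derivatives in one fixed order, whereas a class with several directions
    contains derivatives in every order. With a single direction the two agree and no interchange of
    partial derivatives arises; this is why the Fourier decay is obtained one axis at a time.

    The two bounds on the radius serve different ends. [c0 * rho <= r] turns the negative powers of
    [r], in the bump estimates and in the volume, into powers of rho. [r <= C0 * rho] bounds the
    volume of the support and, for R_B large, keeps the dilated ball away from the origin. *)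

(** * Differentiation along a direction *)

Section directional_calculus.
Context {R : realType} {V : normedModType R}.
Implicit Types (f : V -> R) (x v : V).

Lemma continuousM1 (f g : V -> R) : continuous f -> continuous g ->
  continuous (fun x => f x * g x).
Proof. by move=> cf cg x; exact: (continuousM (cf x) (cg x)). Qed.

Lemma continuousD1 (f g : V -> R) : continuous f -> continuous g ->
  continuous (fun x => f x + g x).
Proof. by move=> cf cg x; exact: (continuousD (cf x) (cg x)). Qed.

Lemma continuous_sum1 n (h : 'I_n -> V -> R) : (forall i, continuous (h i)) ->
  continuous (fun x => \sum_(i < n) h i x).
Proof.
move=> ch; elim: n h ch => [|n ih] h ch.
  under eq_fun do rewrite big_ord0.
  exact: cst_continuous.
under eq_fun do rewrite big_ord_recl.
by apply: continuousD1 => //; exact: ih.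
Qed.

Lemma continuous_comp1 (phi : R -> R) (f : V -> R) : continuous f ->
  (forall x, {for f x, continuous phi}) -> continuous (fun x => phi (f x)).
Proof. by move=> cf cphi x; exact: (continuous_comp (cf x) (cphi x)). Qed.

(** Only the derivative of [f] along [v] is assumed, not Fréchet differentiability: restriction to
    the line [h *: v + x] leaves the difference quotients unchanged and reduces the claim to the
    chain rule in one variable. *)
Lemma is_derive_comp1 (phi : R -> R) f x v (a b : R) :
  is_derive (f x) 1 phi b -> is_derive x v f a ->
  is_derive x v (fun y => phi (f y)) (b * a).
Proof.
move=> dphi df; pose l := fun h : R => f (h *: v + x).
have lineE (g : V -> R) :
    (fun h : R => h^-1 *: ((g \o shift x) (h *: v) - g x)) =
    (fun h : R => h^-1 *: (((fun h => g (h *: v + x)) \o shift 0) (h *: 1) -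
                            g (0 *: v + x))).
  by apply/funext => h /=; rewrite addr0 scale0r add0r [_%:A]mulr1.
have dl : is_derive (0 : R) 1 l a.
  case: df => df <-; split; first by move: df; rewrite /derivable lineE.
  by rewrite /derive lineE.
have l0 : l 0 = f x by rewrite /l scale0r add0r.
have dphil : is_derive (0 : R) 1 (phi \o l) (b * a).
  by apply: is_derive1_comp; rewrite l0.
case: dphil => dphil <-; split; last by rewrite /derive (lineE (phi \o f)).
by move: dphil; rewrite /derivable (lineE (phi \o f)).
Qed.

Lemma is_deriveM1 f g x v (a b : R) : is_derive x v f a -> is_derive x v g b ->
  is_derive x v (fun y => f y * g y) (a * g x + f x * b).
Proof.
move=> df dg; have := @is_deriveM _ _ f g x v a b df dg.
by move=> h; apply: is_derive_eq; rewrite addrC /GRing.scale/= [g x * a]mulrC.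
Qed.

Lemma is_deriveV1 f x v (a : R) : f x != 0 -> is_derive x v f a ->
  is_derive x v (fun y => (f y)^-1) (- (f x) ^- 2 * a).
Proof.
move=> fx df; split; first exact: derivableV.
by rewrite deriveV//; rewrite derive_val.
Qed.

Lemma derive_out (S : set V) f x v : closed S ->
  (forall y, ~ S y -> f y = 0) -> ~ S x -> is_derive x v f 0.
Proof.
move=> cS f0 Sx; apply: (@near_eq_is_derive _ _ _ (cst 0)).
have : nbhs x (~` S) by apply: open_nbhs_nbhs; split => //; exact: closed_openC.
by apply: filterS => y Sy; rewrite f0.
Qed.

End directional_calculus.

(** * Classes of functions whose derivatives up to a given order have prescribed size *)

Section symbol_class.
Context {R : realType} {d : nat}.
Implicit Types (I : Type) (J : pred 'I_d).
Local Notation V := 'rV[R]_d.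
Local Notation e_ j := (delta_mx 0 j : V).

(* The constants are shared by all members [f i] of the family, which is what
   makes the Miyachi bound uniform in the ball and in the bump. *)
Fixpoint symb I (D : I -> set V) (kap : I -> V -> R) J (n : nat)
    (w f : I -> V -> R) : Prop :=
  [/\ forall i, continuous (f i),
      exists C : R, forall i x, D i x -> `|f i x| <= C * w i x &
      if n is n'.+1 then forall j, J j ->
        (forall i x, derivable (f i) x (e_ j)) /\
        symb D kap J n' (fun i x => w i x * kap i x)
                        (fun i x => 'D_(e_ j) (f i) x)
      else True].

Section fixed_family.
Context {I : Type} (D : I -> set V) (kap : I -> V -> R) (J : pred 'I_d).
Hypothesis kap0 : forall i x, D i x -> 0 <= kap i x.
Implicit Types (w f : I -> V -> R).
Local Notation symb := (symb D kap J).

Lemma symb_continuous n w f : symb n w f -> forall i, continuous (f i).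
Proof. by case: n => [|n] []. Qed.

(** Used to absorb surplus decay, such as a derivative that gains [1 / |x|] where only [kap] is
    claimed. Nonnegativity of [kap] carries the comparison of weights to the next order. *)
Lemma symb_weight n w w' f (C : R) :
  (forall i x, D i x -> 0 <= w i x <= C * w' i x) -> symb n w f -> symb n w' f.
Proof.
elim: n w w' f => [|n ih] w w' f ww' [cf [K fK] h].
- split => //; exists (`|K| * C) => i x Dx; have /andP[w0 wC] := ww' _ _ Dx.
  rewrite (le_trans (fK _ _ Dx))// (@le_trans _ _ (`|K| * w i x))//.
    by rewrite ler_wpM2r// ler_norm.
  by rewrite -mulrA ler_wpM2l.
- split => //.
    exists (`|K| * C) => i x Dx; have /andP[w0 wC] := ww' _ _ Dx.
    rewrite (le_trans (fK _ _ Dx))// (@le_trans _ _ (`|K| * w i x))//.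
      by rewrite ler_wpM2r// ler_norm.
    by rewrite -mulrA ler_wpM2l.
  move=> j Jj; have [df sf] := h _ Jj; split => //; apply: ih sf => i x Dx.
  have /andP[w0 wC] := ww' _ _ Dx.
  by rewrite mulr_ge0 ?kap0//= mulrA ler_wpM2r// kap0.
Qed.

Lemma symb_eqw n w w' f : (forall i x, w i x = w' i x) -> symb n w f -> symb n w' f.
Proof. by move=> ww'; rewrite (_ : w = w')//; apply/funext => i; apply/funext. Qed.

Lemma symb_eqf n w f g : (forall i x, f i x = g i x) -> symb n w f -> symb n w g.
Proof. by move=> ww'; rewrite (_ : f = g)//; apply/funext => i; apply/funext. Qed.

Lemma symbW n w f : symb n.+1 w f -> symb n w f.
Proof.
elim: n w f => [|n ih] w f [cf bf h]; split => // j Jj; have [df sf] := h _ Jj.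
by split => //; exact: ih.
Qed.

(** The inductive step of the estimates below: an explicit formula [df] replaces the operator ['D],
    so that derivability and the class of the derivative come from one differentiation rule. *)
Lemma symb_derivative n w f (df : 'I_d -> I -> V -> R) :
  (forall i, continuous (f i)) ->
  (exists C : R, forall i x, D i x -> `|f i x| <= C * w i x) ->
  (forall j, J j -> forall i x, is_derive x (e_ j) (f i) (df j i x)) ->
  (forall j, J j -> symb n (fun i x => w i x * kap i x) (df j)) ->
  symb n.+1 w f.
Proof.
move=> cf bf dfE sdf; split => // j Jj; split => [i x|].
  by apply: ex_derive; exact: dfE.
rewrite (_ : (fun i x => 'D_(e_ j) (f i) x) = df j); first exact: sdf.
by apply/funext => i; apply/funext => x; have [] := dfE j Jj i x.
Qed.

Lemma symb_scale n w f (c : R) : symb n w f -> symb n w (fun i x => c * f i x).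
Proof.
elim: n w f => [|n ih] w f [cf [K fK] h].
- split => // [i|]; first by apply: continuousM1 => //; exact: cst_continuous.
  by exists (`|c| * K) => i x Dx; rewrite normrM -mulrA ler_wpM2l// fK.
- apply: (@symb_derivative _ _ _ (fun j i x => c * 'D_(e_ j) (f i) x)).
  + by move=> i; apply: continuousM1 => //; exact: cst_continuous.
  + by exists (`|c| * K) => i x Dx; rewrite normrM -mulrA ler_wpM2l// fK.
  + move=> j Jj i x; have [df _] := h j Jj.
    exact: (is_deriveZ c (derivableP (df i x))).
  + by move=> j Jj; apply: ih; have [] := h j Jj.
Qed.

Lemma symb_add n w f g : symb n w f -> symb n w g ->
  symb n w (fun i x => f i x + g i x).
Proof.
have bfg w' f' g' : (exists C : R, forall i x, D i x -> `|f' i x| <= C * w' i x) ->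
  (exists C : R, forall i x, D i x -> `|g' i x| <= C * w' i x) ->
  exists C : R, forall i x, D i x -> `|f' i x + g' i x| <= C * w' i x.
  move=> [C1 h1] [C2 h2]; exists (C1 + C2) => i x Dx.
  by rewrite mulrDl (le_trans (ler_normD _ _))// lerD ?h1 ?h2.
elim: n w f g => [|n ih] w f g [cf bf h] [cg bg k].
- by split => // [i|]; [exact: continuousD1|exact: bfg].
- apply: (@symb_derivative _ _ _
     (fun j i x => 'D_(e_ j) (f i) x + 'D_(e_ j) (g i) x)).
  + by move=> i; exact: continuousD1.
  + exact: bfg.
  + move=> j Jj i x; have [df _] := h j Jj; have [dg _] := k j Jj.
    exact: is_deriveD (derivableP (df i x)) (derivableP (dg i x)).
  + by move=> j Jj; apply: ih; [have [] := h j Jj|have [] := k j Jj].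
Qed.

(** By the Leibniz rule each of the two terms carries exactly one factor [kap]; the factor left
    undifferentiated drops to order [n] by [symbW]. *)
Lemma symb_mul n w v f g :
  (forall i x, D i x -> 0 <= w i x) -> (forall i x, D i x -> 0 <= v i x) ->
  symb n w f -> symb n v g -> symb n (fun i x => w i x * v i x) (fun i x => f i x * g i x).
Proof.
have bfg w' v' f' g' : (forall i x, D i x -> 0 <= w' i x) ->
  (forall i x, D i x -> 0 <= v' i x) ->
  (exists C : R, forall i x, D i x -> `|f' i x| <= C * w' i x) ->
  (exists C : R, forall i x, D i x -> `|g' i x| <= C * v' i x) ->
  exists C : R, forall i x, D i x -> `|f' i x * g' i x| <= C * (w' i x * v' i x).
  move=> w0 v0 [C1 h1] [C2 h2]; exists (`|C1| * `|C2|) => i x Dx.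
  rewrite mulrACA normrM; apply: ler_pM => //.
    by rewrite (le_trans (h1 _ _ Dx))// ler_wpM2r ?ler_norm ?w0.
  by rewrite (le_trans (h2 _ _ Dx))// ler_wpM2r ?ler_norm ?v0.
elim: n w v f g => [|n ih] w v f g w0 v0 sf sg.
- case: sf => cf bf _; case: sg => cg bg _.
  by split => // [i|]; [exact: continuousM1|exact: bfg].
- case: (sf) => cf bf h; case: (sg) => cg bg k.
  apply: (@symb_derivative _ _ _
     (fun j i x => 'D_(e_ j) (f i) x * g i x + f i x * 'D_(e_ j) (g i) x)).
  + by move=> i; exact: continuousM1.
  + exact: bfg.
  + move=> j Jj i x; have [df _] := h j Jj; have [dg _] := k j Jj.
    exact: is_deriveM1 (derivableP (df i x)) (derivableP (dg i x)).
  + have wk w1 : (forall i x, D i x -> 0 <= w1 i x) ->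
        forall i x, D i x -> 0 <= w1 i x * kap i x.
      by move=> w10 i x Dx; rewrite mulr_ge0 ?w10 ?kap0.
    move=> j Jj; apply: symb_add.
    * apply: (@symb_eqw _ (fun i x => (w i x * kap i x) * v i x)).
        by move=> i x; rewrite mulrAC.
      apply: ih => //; [exact: wk| by have [] := h j Jj|exact: symbW].
    * apply: (@symb_eqw _ (fun i x => w i x * (v i x * kap i x))).
        by move=> i x; rewrite mulrA.
      apply: ih => //; [exact: wk|exact: symbW| by have [] := k j Jj].
Qed.

Lemma symb_iter n w f (s : seq 'I_d) : symb n w f -> all J s -> (size s <= n)%N ->
  symb (n - size s) (fun i x => w i x * kap i x ^+ size s)
    (fun i => foldr (fun j g x => 'D_(e_ j) g x) (f i) s).
Proof.
(* [foldr] applies the last letter of [s] first, and that is the derivative which the recursion of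
   [symb] peels off. *)
elim/last_ind: s n w f => [|s j ih] n w f sf.
  by rewrite subn0 => _ _; apply: symb_eqw sf => i x; rewrite expr0 mulr1.
rewrite all_rcons size_rcons => /andP[Jj Js]; case: n sf => // n [_ _ h] sn.
have [_ sdf] := h _ Jj; have := ih _ _ _ sdf Js sn; rewrite subSS.
move=> H; apply: symb_eqw; last first.
  apply: symb_eqf H => i x; by rewrite foldr_rcons.
by move=> i x /=; rewrite exprS mulrA.
Qed.

End fixed_family.

(** Change of index along [t], with smaller sets, fewer directions and comparable weights. It
    carries the estimate of the symbol, proved once in the variable [x], to all balls at once; each
    derivative multiplies the comparison constant by [C']. *)
Lemma symb_pull I I' (D : I -> set V) (D' : I' -> set V) (kap : I -> V -> R)
    (kap' : I' -> V -> R) (J J' : pred 'I_d) (n : nat) (w f : I -> V -> R)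
    (w' : I' -> V -> R) (t : I' -> I) (C C' : R) :
  subpred J' J -> (forall i, D' i `<=` D (t i)) ->
  (forall i x, D' i x -> 0 <= w (t i) x <= C * w' i x) ->
  (forall i x, D' i x -> 0 <= kap (t i) x <= C' * kap' i x) ->
  symb D kap J n w f -> symb D' kap' J' n w' (f \o t).
Proof.
move=> JJ DD + kk; elim: n w f w' C => [|n ih] w f w' C ww [cf [K fK] h].
all: have bf : exists C0 : R, forall i x, D' i x -> `|(f \o t) i x| <= C0 * w' i x.
  1,3: exists (`|K| * C) => i x D'x; have Dx := DD _ _ D'x;
    have /andP[w0 wC] := ww _ _ D'x;
    rewrite (le_trans (fK _ _ Dx))// (@le_trans _ _ (`|K| * w (t i) x))//;
    rewrite ?ler_wpM2r ?ler_norm// -mulrA ler_wpM2l//.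
- by split => // i; exact: cf.
- split => // [i|j /JJ Jj]; first exact: cf.
  have [df sf] := h _ Jj; split => [i x|]; first exact: df.
  apply: (ih (fun i x => w i x * kap i x) (fun i x => 'D_(e_ j) (f i) x)
            (fun i x => w' i x * kap' i x) (C * C')) => // i x D'x.
  have /andP[w0 wC] := ww _ _ D'x; have /andP[k0 kC] := kk _ _ D'x.
  by rewrite mulr_ge0//= mulrACA ler_pM.
Qed.

End symbol_class.

(** * The logarithmic symbol *)

Section reals.
Context {R : realType}.
Implicit Types (a k u v x : R).

(** Comparability is symmetric in [u] and [v], so a negative exponent is treated by passing to
    inverses. One constant then covers both signs of beta. *)
Lemma powR_comparable a k u v : 1 <= k -> 0 < u -> k^-1 * u <= v <= k * u ->
  v `^ a <= k `^ `|a| * u `^ a.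
Proof.
move=> k1 u0 /andP[uv vu]; have k0 : 0 < k by exact: lt_le_trans k1.
have v0 : 0 < v by rewrite (lt_le_trans _ uv)// mulr_gt0// invr_gt0.
have [a0|a0] := leP 0 a.
  rewrite ger0_norm// -powRM ?(ltW k0) ?(ltW u0)//.
  by rewrite ge0_ler_powR// nnegrE ?mulr_ge0 ?(ltW k0) ?(ltW u0) ?(ltW v0).
rewrite ltr0_norm// -[a in v `^ a]opprK -[a in u `^ a]opprK !(powRN _ (- a)).
rewrite ler_pdivlMr ?powR_gt0// mulrC ler_pdivrMr ?powR_gt0//.
rewrite -powRM ?(ltW k0) ?(ltW v0)//.
rewrite ge0_ler_powR ?nnegrE ?mulr_ge0 ?oppr_ge0 ?(ltW k0) ?(ltW u0) ?(ltW v0) ?(ltW a0)//.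
by move: uv; rewrite mulrC ler_pdivrMr// mulrC.
Qed.

Lemma continuous_powR a x : 0 < x -> {for x, continuous (fun y : R => y `^ a)}.
Proof.
move=> x0; apply/differentiable_continuous/derivable1_diffP.
by apply: ex_derive; exact: is_derive1_powR.
Qed.

End reals.

Section euclidean.
Context {R : realType} {d : nat}.
Local Notation V := 'rV[R]_d.
Implicit Types (x y : V).

Lemma dotp_ge0 x : 0 <= dotp x x.
Proof. by apply: sumr_ge0 => i _; rewrite -expr2 sqr_ge0. Qed.

Lemma enorm_ge0 x : 0 <= enorm x.
Proof. exact: sqrtr_ge0. Qed.

Lemma enormE x : enorm x ^+ 2 = dotp x x.
Proof. by rewrite sqr_sqrtr// dotp_ge0. Qed.

Lemma coord_le_enorm x i : `|x 0 i| <= enorm x.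
Proof.
rewrite -(@ler_pXn2r _ 2) ?nnegrE ?enorm_ge0// enormE real_normK ?num_real//.
rewrite /dotp (bigD1 i)//= -expr2 lerDl sumr_ge0// => j _.
by rewrite -expr2 sqr_ge0.
Qed.

Lemma coord_is_derive (i j : 'I_d) x :
  is_derive x (delta_mx 0 j) (fun y : V => y 0 i) (i == j)%:R.
Proof.
have did := @derivable_id R V x (delta_mx 0 j).
split; first exact: (derivable_mxP id x (delta_mx 0 j)).1 did 0 i.
by have := derive_mx did; rewrite derive_id => /matrixP/(_ 0 i); rewrite !mxE.
Qed.

Lemma continuous_coord (i : 'I_d) : continuous (fun y : V => y 0 i).
Proof. exact: coord_continuous. Qed.

End euclidean.

Section log_symbol.
Context {R : realType} {d : nat} (gamma : R).
Hypothesis gamma1 : 1 < gamma.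
Local Notation V := 'rV[R]_d.
Local Notation e_ j := (delta_mx 0 j : V).
Implicit Types (x : V).

Definition Qf x : R := expR 2 + dotp x x.

Lemma Qf_ge x : expR 2 <= Qf x.
Proof. by rewrite lerDl dotp_ge0. Qed.

Lemma Qf_gt0 x : 0 < Qf x.
Proof. exact: lt_le_trans (expR_gt0 _) (Qf_ge x). Qed.

Lemma LE x : L x = 2^-1 * ln (Qf x).
Proof. by rewrite /L enormE. Qed.

Lemma L_ge1 x : 1 <= L x.
Proof.
have : ln (expR 2) <= ln (Qf x) by rewrite ler_ln ?posrE ?expR_gt0 ?Qf_gt0 ?Qf_ge.
by rewrite expRK LE; lra.
Qed.

Lemma L_gt0 x : 0 < L x.
Proof. exact: lt_le_trans (L_ge1 x). Qed.

Lemma Qf_is_derive (j : 'I_d) x : is_derive x (e_ j) Qf (2 * x 0 j).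
Proof.
have -> : Qf = cst (expR 2) + \sum_(i < d) (fun y : V => y 0 i * y 0 i).
  by apply/funext => y; rewrite /Qf /dotp fctE fct_sumE.
have -> : 2 * x 0 j = 0 + \sum_(i < d) ((i == j)%:R * x 0 i + x 0 i * (i == j)%:R).
  rewrite add0r (bigD1 j)//= eqxx mul1r mulr1 big1 ?addr0 => [|i /negPf->].
    by rewrite mulr_natl mulr2n.
  by rewrite mul0r mulr0 addr0.
apply: is_deriveD; apply: is_derive_sum => i.
by apply: is_deriveM1; exact: coord_is_derive.
Qed.

Lemma continuous_Qf : continuous (Qf : V -> R).
Proof.
have -> : Qf = fun y : V => expR 2 + dotp y y by [].
apply: continuousD1; first exact: cst_continuous.
apply: continuous_sum1 => i.
by apply: continuousM1; exact: continuous_coord.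
Qed.

Lemma L_is_derive (j : 'I_d) x : is_derive x (e_ j) (@L R d) (x 0 j / Qf x).
Proof.
have -> : (@L R d) = (fun y => 2^-1 * ln (Qf y)) by apply/funext => y; rewrite LE.
have -> : x 0 j / Qf x = (2^-1 * (Qf x)^-1) * (2 * x 0 j).
  have := lt0r_neq0 (Qf_gt0 x); move=> ?; by field.
apply: (is_derive_comp1 (phi := fun t => 2^-1 * ln t)); last exact: Qf_is_derive.
exact: (is_deriveZ 2^-1 (is_derive1_ln (Qf_gt0 x))).
Qed.

Lemma continuous_L : continuous (@L R d).
Proof.
have -> : (@L R d) = fun y => 2^-1 * ln (Qf y) by apply/funext => y; rewrite LE.
apply: continuousM1; first exact: cst_continuous.
apply: continuous_comp1 => [|x]; first exact: continuous_Qf.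
exact: continuous_ln (Qf_gt0 x).
Qed.

Lemma continuous_Lpow (a : R) : continuous (fun x : V => L x `^ a).
Proof.
apply: (@continuous_comp1 _ _ (fun y : R => y `^ a)) => [|x].
  exact: continuous_L.
exact: continuous_powR (L_gt0 x).
Qed.

(** The symbol does not depend on a ball, hence a family with a single member. From [e^2] on,
    [ln |x|] is at least 2, which makes its powers monotone in the exponent. *)
Let D (_ : unit) : set V := [set x | expR 2 <= enorm x].
Let kap (_ : unit) x : R := ln (enorm x) `^ (gamma - 1) / enorm x.
Let J : pred 'I_d := predT.

Lemma enorm_gt0_hf x : expR 2 <= enorm x -> 0 < enorm x.
Proof. exact: lt_le_trans (expR_gt0 _). Qed.

Lemma ln_enorm_ge2 x : expR 2 <= enorm x -> 2 <= ln (enorm x).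
Proof.
move=> xD; have : ln (expR 2) <= ln (enorm x).
  by rewrite ler_ln ?posrE ?expR_gt0// enorm_gt0_hf.
by rewrite expRK.
Qed.

Let Dgt0 x : expR 2 <= enorm x -> 0 < enorm x := @enorm_gt0_hf x.
Let Dln x : expR 2 <= enorm x -> 2 <= ln (enorm x) := @ln_enorm_ge2 x.

Let kap0 i x : D i x -> 0 <= kap i x.
Proof. by move=> /Dgt0/ltW x0; rewrite divr_ge0 ?powR_ge0. Qed.

(** Since [gamma > 1] and [ln |x| >= 1], a derivative with the classical gain [1 / |x|] is
    admissible; the rational factors are estimated this way. *)
Let inv_kap i x : D i x -> (enorm x)^-1 <= kap i x.
Proof.
move=> /[dup] /Dgt0 x0 /Dln l2; rewrite /kap ler_pdivlMr// mulVf ?gt_eqF//.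
rewrite -[leLHS](powRr0 (ln (enorm x))); apply: ler_powR; last by rewrite subr_ge0 ltW.
by rewrite (le_trans _ l2)// ler1n.
Qed.

(** The system closes by the formulas d_j (1/Q) = -2 (x_j/Q)(1/Q) and d_j (x_i/Q) = delta_ij (1/Q) -
    2 (x_i/Q)(x_j/Q). Each right-hand side gains a factor [1 / |x|], then weakened to [kap]. *)
Lemma symb_coordQ n :
  symb D kap J n (fun _ x => enorm x ^- 2) (fun _ x => (Qf x)^-1) /\
  forall i, symb D kap J n (fun _ x => (enorm x)^-1) (fun _ x => x 0 i / Qf x).
Proof.
have Qle x : expR 2 <= enorm x -> enorm x ^+ 2 <= Qf x.
  by rewrite enormE lerDr expR_ge0.
have cQV : continuous (fun x : V => (Qf x)^-1).
  apply: continuous_comp1 => [|x]; first exact: continuous_Qf.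
  by apply: cvgV; [rewrite gt_eqF ?Qf_gt0|].
have bQV : exists C : R, forall i x, D i x -> `|(Qf x)^-1| <= C * enorm x ^- 2.
  exists 1 => i x Dx; rewrite mul1r normfV (gtr0_norm (Qf_gt0 x)).
  by rewrite lef_pV2 ?posrE ?Qf_gt0 ?exprn_gt0 ?Dgt0// Qle.
have cq i : continuous (fun x : V => x 0 i / Qf x).
  by apply: continuousM1 => //; exact: continuous_coord.
have bq j : exists C : R, forall i x, D i x -> `|x 0 j / Qf x| <= C * (enorm x)^-1.
  exists 1 => i x Dx; rewrite mul1r normrM normfV (gtr0_norm (Qf_gt0 x)).
  rewrite ler_pdivrMr ?Qf_gt0// mulrC ler_pdivlMr ?Dgt0//.
  rewrite (le_trans _ (Qle _ Dx))// expr2 ler_wpM2r ?enorm_ge0//.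
  exact: coord_le_enorm.
elim: n => [|n [ihQ ihq]]; first by split => [|j]; split.
have wV i x : D i x -> 0 <= (enorm x)^-1.
  by move=> Dx; rewrite invr_ge0 enorm_ge0.
have wV2 i x : D i x -> 0 <= enorm x ^- 2.
  by move=> Dx; rewrite invr_ge0 exprn_ge0 ?enorm_ge0.
split => [|i].
  apply: (@symb_derivative _ _ _ _ _ _ _ _ _ (fun j _ x =>
      -2 * (x 0 j / Qf x * (Qf x)^-1))) => //.
    move=> j _ i x; have := @is_deriveV1 _ _ _ _ _ _ _ (Qf_is_derive j x).
    move/(_ (lt0r_neq0 (Qf_gt0 x))) => h; apply: (is_derive_eq h).
    by rewrite -exprVn; ring.
  move=> j _; apply: symb_scale.
  apply: (@symb_weight _ _ _ _ _ _ kap0 _ _ _ _ 1); last first.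
    exact: (symb_mul kap0 _ _ (ihq j) ihQ).
  move=> k x Dx; rewrite mul1r mulr_ge0 ?(wV k _ Dx) ?(wV2 k _ Dx)//= mulrC ler_wpM2l//.
    exact: wV2 k _ Dx.
  exact: inv_kap.
apply: (@symb_derivative _ _ _ _ _ _ _ _ _ (fun j _ x =>
    (i == j)%:R * (Qf x)^-1 + (-2) * ((x 0 i / Qf x) * (x 0 j / Qf x)))) => //.
  move=> j _ k x; have := @is_deriveV1 _ _ _ _ _ _ _ (Qf_is_derive j x).
  move/(_ (lt0r_neq0 (Qf_gt0 x))) => /(is_deriveM1 (coord_is_derive i j x)) => h.
  by apply: (is_derive_eq h); rewrite -exprVn; ring.
move=> j _; apply: symb_add; apply: symb_scale.
  apply: (@symb_weight _ _ _ _ _ _ kap0 _ _ _ _ 1); last exact: ihQ.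
  move=> k x Dx; rewrite mul1r (wV2 k _ Dx)//= expr2 invfM ler_wpM2l//.
    exact: wV k _ Dx.
  exact: inv_kap.
apply: (@symb_weight _ _ _ _ _ _ kap0 _ _ _ _ 1); last first.
  exact: (symb_mul kap0 _ _ (ihq i) (ihq j)).
move=> k x Dx; rewrite mul1r mulr_ge0 ?(wV k _ Dx)//= ler_wpM2l//.
  exact: wV k _ Dx.
exact: inv_kap.
Qed.

Lemma L_ln x : expR 2 <= enorm x -> ln (enorm x) <= L x <= 2 * ln (enorm x).
Proof.
move=> Dx; have x0 := enorm_gt0_hf Dx; have l2 := ln_enorm_ge2 Dx.
have lnX m : ln (enorm x ^+ m) = m%:R * ln (enorm x).
  by rewrite lnXn// mulr_natl.
have e1 : 1 <= expR 2 :> R by rewrite -expR0 ler_expR.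
have lo : ln (enorm x ^+ 2) <= ln (Qf x).
  by rewrite ler_ln ?posrE ?exprn_gt0 ?Qf_gt0// /Qf -enormE lerDr expR_ge0.
(* As [|x| >= e^2], one has e^2 + |x|^2 <= 2 |x|^2 <= |x|^4; the exponent 4 and the factor 1/2 in
   [L] give the constant 2. *)
have hi : ln (Qf x) <= ln (enorm x ^+ 4).
  rewrite ler_ln ?posrE ?exprn_gt0 ?Qf_gt0// /Qf -enormE.
  have e2 : 2 <= expR 2 :> R by have := expR_ge1Dx (2 : R); lra.
  have xx : 2 <= enorm x by exact: le_trans Dx.
  have e2x : expR 2 <= enorm x ^+ 2 by rewrite (le_trans Dx)// expr2; nra.
  have : 2 * enorm x ^+ 2 <= enorm x ^+ 4.
    by rewrite (_ : 4 = 2 + 2)%N// exprD ler_wpM2r ?sqr_ge0// (le_trans e2).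
  lra.
by move: lo hi; rewrite !lnX LE; lra.
Qed.

(** The exponent varies in the induction, because differentiation produces [L ^ (a - 1)]. The
    logarithm gained in this way is given up, as [ln |x| >= 1]. *)
Lemma symb_Lpow n (a : R) :
  symb D kap J n (fun i x => ln (enorm x) `^ a) (fun _ x => L x `^ a).
Proof.
have bL b : exists C : R, forall i x, D i x -> `|L x `^ b| <= C * ln (enorm x) `^ b.
  exists (2 `^ `|b|) => i x Dx; rewrite ger0_norm ?powR_ge0//.
  have /andP[l1 l2] := L_ln Dx; have l := ln_enorm_ge2 Dx.
  apply: powR_comparable; [lra|lra|].
  by rewrite l2 andbT (le_trans _ l1)//; lra.
elim: n a => [|n ih] a; first by split => // i; exact: continuous_Lpow.
apply: (@symb_derivative _ _ _ _ _ _ _ _ _ (fun j _ x =>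
    a * (L x `^ (a - 1) * (x 0 j / Qf x)))) => //.
- by move=> _; exact: continuous_Lpow.
- move=> j _ _ x.
  have h := is_derive_comp1 (is_derive1_powR a (L_gt0 x)) (L_is_derive j x).
  by apply: (is_derive_eq h); rewrite -mulrA.
- move=> j _; apply: symb_scale.
  apply: (@symb_weight _ _ _ _ _ _ kap0 _ _ _ _ 1); last first.
    apply: (symb_mul kap0 _ _ (ih (a - 1)) ((symb_coordQ n).2 j)).
    + by move=> k x Dx; exact: powR_ge0.
    + by move=> k x Dx; rewrite invr_ge0 enorm_ge0.
  move=> k x Dx; rewrite mul1r mulr_ge0 ?powR_ge0 ?invr_ge0 ?enorm_ge0//=.
  have l2 := ln_enorm_ge2 Dx.
  apply: ler_pM; rewrite ?powR_ge0 ?invr_ge0 ?enorm_ge0 ?inv_kap//.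
  by apply: ler_powR; lra.
Qed.

(** This is where the size of [kap] comes from: the phase has derivative
    [gamma * L ^ (gamma - 1) * x_j / Q], whose natural bound is [kap] itself. Differentiation
    exchanges sine and cosine, hence the joint induction. *)
Lemma symb_cis n :
  symb D kap J n (fun _ _ => 1) (fun _ x => cos (L x `^ gamma)) /\
  symb D kap J n (fun _ _ => 1) (fun _ x => sin (L x `^ gamma)).
Proof.
have cc : continuous (fun x : V => cos (L x `^ gamma)).
  apply: (@continuous_comp1 _ _ cos) => [|x]; first exact: continuous_Lpow.
  exact: continuous_cos.
have cs : continuous (fun x : V => sin (L x `^ gamma)).
  apply: (@continuous_comp1 _ _ sin) => [|x]; first exact: continuous_Lpow.
  exact: continuous_sin.
have bc : exists C : R, forall (i : unit) x, D i x -> `|cos (L x `^ gamma)| <= C * 1.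
  by exists 1 => i x _; rewrite mulr1 ler_norml cos_geN1 cos_le1.
have bs : exists C : R, forall (i : unit) x, D i x -> `|sin (L x `^ gamma)| <= C * 1.
  by exists 1 => i x _; rewrite mulr1 ler_norml sin_geN1 sin_le1.
elim: n => [|n [ihc ihs]]; first by split; split.
have dL j x : is_derive x (e_ j) (fun y => L y `^ gamma)
    (gamma * (L x `^ (gamma - 1) * (x 0 j / Qf x))).
  have h := is_derive_comp1 (is_derive1_powR gamma (L_gt0 x)) (L_is_derive j x).
  by apply: (is_derive_eq h); rewrite -mulrA.
have sdL j f : symb D kap J n (fun _ _ => 1) f -> symb D kap J n
    (fun i x => 1 * kap i x)
    (fun i x => gamma * (f i x * (L x `^ (gamma - 1) * (x 0 j / Qf x)))).
  move=> sf; apply: symb_scale; apply: symb_mul => //.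
  apply: (symb_mul kap0 _ _ (symb_Lpow n (gamma - 1)) ((symb_coordQ n).2 j)).
  - by move=> k x _; exact: powR_ge0.
  - by move=> k x Dx; rewrite invr_ge0 enorm_ge0.
split.
- apply: (@symb_derivative _ _ _ _ _ _ _ _ _ (fun j _ x =>
    (-1) * (gamma * (sin (L x `^ gamma) * (L x `^ (gamma - 1) * (x 0 j / Qf x)))))) => //.
    move=> j _ _ x.
    have h := is_derive_comp1 (f := fun y => L y `^ gamma)
      (is_derive_cos (L x `^ gamma)) (dL j x).
    by apply: (is_derive_eq h); ring.
  by move=> j _; apply: symb_scale; exact: (sdL j (fun _ x => sin (L x `^ gamma))).
- apply: (@symb_derivative _ _ _ _ _ _ _ _ _ (fun j _ x =>
    (gamma * (cos (L x `^ gamma) * (L x `^ (gamma - 1) * (x 0 j / Qf x)))))) => //.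
    move=> j _ _ x.
    have h := is_derive_comp1 (f := fun y => L y `^ gamma)
      (is_derive_sin (L x `^ gamma)) (dL j x).
    by apply: (is_derive_eq h); ring.
  by move=> j _; exact: (sdL j (fun _ x => cos (L x `^ gamma))).
Qed.

Lemma symb_msym n (beta : R) :
  symb D kap J n (fun i x => ln (enorm x) `^ (- beta)) (fun _ => re (msym gamma beta)) /\
  symb D kap J n (fun i x => ln (enorm x) `^ (- beta)) (fun _ => im (msym gamma beta)).
Proof.
have w0 (i : unit) x : D i x -> 0 <= ln (enorm x) `^ (- beta) by rewrite powR_ge0.
split.
- apply: (symb_eqf (f := fun i x => L x `^ (- beta) * cos (L x `^ gamma))).
    by move=> _ x; rewrite /re /msym /cis /= mul0r subr0.
  apply: (symb_eqw (w := fun i x => ln (enorm x) `^ (- beta) * 1)).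
    by move=> _ x; rewrite mulr1.
  by apply: symb_mul => //; [exact: symb_Lpow|exact: (symb_cis n).1].
- apply: (symb_eqf (f := fun i x => L x `^ (- beta) * sin (L x `^ gamma))).
    by move=> _ x; rewrite /im /msym /cis /= mul0r addr0.
  apply: (symb_eqw (w := fun i x => ln (enorm x) `^ (- beta) * 1)).
    by move=> _ x; rewrite mulr1.
  by apply: symb_mul => //; [exact: symb_Lpow|exact: (symb_cis n).2].
Qed.

End log_symbol.

(** * Complex-valued functions and the pointwise estimate *)

Section derivatives_of_complex_functions.
Context {R : realType} {d : nat}.
Local Notation V := 'rV[R]_d.
Local Notation e_ j := (delta_mx 0 j : V).

Lemma re_partials s (f : V -> R[i]) :
  re (partials s f) = foldr (fun j g x => 'D_(e_ j) g x) (re f) s.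
Proof. by elim: s => //= j s <-. Qed.

Lemma im_partials s (f : V -> R[i]) :
  im (partials s f) = foldr (fun j g x => 'D_(e_ j) g x) (im f) s.
Proof. by elim: s => //= j s <-. Qed.

Lemma size_mderiv (nu : {ffun 'I_d -> nat}) :
  size (flatten [seq nseq (nu i) i | i <- enum 'I_d]) = mlen nu.
Proof.
rewrite size_flatten /shape -map_comp /mlen sumnE big_map big_enum /=.
by apply: eq_bigr => i _; rewrite size_nseq.
Qed.

Lemma cabs_le (z : R[i]) : cabs z <= `|complex.Re z| + `|complex.Im z|.
Proof.
case: z => a b; rewrite /cabs /= -[leRHS]ger0_norm ?addr_ge0// -sqrtr_sqr ler_wsqrtr//.
rewrite sqrrD !real_normK ?num_real// -addrA (addrC (_ *+ 2)) addrA lerDl.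
by rewrite mulrn_wge0// mulr_ge0.
Qed.

End derivatives_of_complex_functions.

Section pointwise_bounds.
Context {R : realType} {d : nat} (gamma : R).
Hypothesis gamma1 : 1 < gamma.
Local Notation V := 'rV[R]_d.

(** [L >= 1] on the whole space, so its powers cause no trouble at the origin. One order more than
    [size s] is requested because [smooth] also asks for derivability of the derivative along
    [s]. *)
Lemma smooth_msym (beta : R) : smooth (@msym R d gamma beta).
Proof.
move=> s; have [sr si] := @symb_msym R d gamma gamma1 (size s).+1 beta.
have aJ : all predT s by exact/allP.
have := symb_iter sr aJ (leqnSn _); have := symb_iter si aJ (leqnSn _).
rewrite subSnn -re_partials -im_partials => -[ci _ di] [cr _ dr]; split.
- exact: cr tt.
- exact: ci tt.
- move=> i x; have [dri _] := dr i isT; have [dii _] := di i isT.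
  by split; [exact: dri tt x|exact: dii tt x].
Qed.

Lemma msym_bound (beta : R) (nu : {ffun 'I_d -> nat}) : exists C : R,
  forall xi : V, expR 2 <= enorm xi ->
    cabs (mderiv nu (msym gamma beta) xi) <=
      C * ln (enorm xi) `^ (- beta) *
        (ln (enorm xi) `^ (gamma - 1) / enorm xi) ^+ mlen nu.
Proof.
set s := flatten [seq nseq (nu i) i | i <- enum 'I_d].
have [sr si] := @symb_msym R d gamma gamma1 (size s) beta.
have aJ : all predT s by exact/allP.
have := symb_iter sr aJ (leqnn _); have := symb_iter si aJ (leqnn _).
rewrite subnn -re_partials -im_partials size_mderiv.
move=> [_ [C1 b1] _] [_ [C2 b2] _].
exists (C2 + C1) => xi xiD; rewrite (le_trans (cabs_le _))//.
rewrite -mulrA mulrDl lerD//; first exact: b2 tt xi xiD.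
exact: b1 tt xi xiD.
Qed.

End pointwise_bounds.

(** * Integration over R^d *)

Section lebesgue_tuple_integration.
Context {R : realType}.
Local Notation MR := (measurableTypeR R).

(** Tuples carry the product sigma-algebra, row vectors the sup-norm topology. The link is that an
    open set is a countable union of cubes with rational centre [p.1] and half-side
    [1 / (p.2 + 1)]. *)
Lemma measurable_of_tuple_open d (U : set 'rV[R]_d) : open U ->
  measurable (of_tuple @^-1` U : set (d.-tuple MR)).
Proof.
move=> oU.
pose box (p : d.-tuple rat * nat) : set 'rV[R]_d :=
  [set x | forall i, `|x 0 i - ratr (tnth p.1 i)| < p.2.+1%:R^-1].
have -> : U = \bigcup_p (if `[< box p `<=` U >] then box p else set0).
  apply/seteqP; split => [x Ux|x [p _]]; last by case: asboolP => // + px; exact.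
  have : nbhs x U by exact: open_nbhs_nbhs.
  move=> /nbhs_ballP[e /= e0 eU].
  (* The factor 2 pays for the triangle inequality through the rational centre. *)
  have [k ke] : exists k : nat, 2 * k.+1%:R^-1 < e :> R.
    have [k _ ke] := near_infty_natSinv_lt (PosNum (divr_gt0 e0 (ltr0n R 2))).
    exists k; have := ke k (leqnn k); rewrite /= ltr_pdivlMr ?ltr0n// mulrC; exact.
  have qP i : exists q : rat, `|x 0 i - ratr q| < k.+1%:R^-1.
    have k0 : 0 < k.+1%:R^-1 :> R by rewrite invr_gt0 ltr0n.
    move: k.+1%:R^-1 k0 => a a0; have xx : x 0 i - a < x 0 i + a by lra.
    have [q] := rat_in_itvoo xx; rewrite in_itv/= => /andP[q1 q2].
    by exists q; rewrite ltr_norml; apply/andP; split; lra.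
  pose q := [tuple sval (cid (qP i)) | i < d].
  have xq : box (q, k) x.
    by move=> i; rewrite /= tnth_mktuple; exact: (svalP (cid (qP i))).
  exists (q, k) => //; case: asboolP => // -[] y yq; apply: eU; split => // i j.
  rewrite (ord1 i) /ball /=; apply: le_lt_trans ke.
  have := yq j; have := xq j; rewrite /= => h1 h2.
  rewrite -(subrKA (ratr (tnth q j))) (le_trans (ler_normD _ _))//.
  by rewrite mulrDl mul1r lerD ?ltW// distrC.
rewrite preimage_bigcup; apply: countable_bigcupT_measurable => // p.
case: asboolP => _; last by rewrite preimage_set0.
rewrite (_ : _ @^-1` _ = \bigcap_(i in [set: 'I_d])
    [set t : d.-tuple MR | `|tnth t i - ratr (tnth p.1 i)| < p.2.+1%:R^-1]).
  apply: fin_bigcap_measurable => // i _.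
  rewrite -[X in measurable X]setTI.
  have : measurable_fun setT (fun t : d.-tuple MR =>
      `|tnth t i - ratr (tnth p.1 i)| < p.2.+1%:R^-1).
    apply: measurable_fun_ltr => //; apply: measurableT_comp => //.
    by apply: measurable_funB => //; exact: measurable_tnth.
  by move=> /(_ measurableT [set true]); apply.
apply/seteqP; split => t /= h i; first by move=> _; have := h i; rewrite mxE.
by rewrite mxE; exact: h.
Qed.

Lemma measurable_of_tuple d (f : 'rV[R]_d -> R) : continuous f ->
  measurable_fun setT (fun t : d.-tuple MR => f (of_tuple t)).
Proof.
move=> /continuousP cf; apply: (measurability _ (RGenOpens.measurableE R)).
move=> _ [_ [a [b ->] <-]]; rewrite setTI.
have oU : open (f @^-1` `]a, b[) by apply: cf; exact: interval_open.
exact: (measurable_of_tuple_open oU).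
Qed.

Lemma ge0_integral_tupleS n (f : n.+1.-tuple MR -> \bar R) :
  (forall t, (0 <= f t)%E) -> measurable_fun setT f ->
  (\int[lebesgue_tuple R n.+1]_t f t =
   \int[@lebesgue_measure R]_x \int[lebesgue_tuple R n]_t f (tuple_of_prod (x, t)))%E.
Proof.
move=> f0 mf.
transitivity (\int[pushforward (@lebesgue_measure R \x lebesgue_tuple R n)%E
    (@tuple_of_prod R n)]_t f t)%E; first by [].
rewrite ge0_integral_pushforward//; last exact: measurable_tuple_of_prod.
rewrite preimage_setT fubini_tonelli1//; last by move=> x; exact: f0.
by apply: measurableT_comp => //; exact: measurable_tuple_of_prod.
Qed.

Lemma integrable_tupleS n (f : n.+1.-tuple MR -> \bar R) :
  (lebesgue_tuple R n.+1).-integrable setT f ->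
  (@lebesgue_measure R \x lebesgue_tuple R n)%E.-integrable setT
    (f \o (@tuple_of_prod R n)).
Proof.
move=> /integrableP[mf intf]; apply/integrableP; split.
  by apply: measurableT_comp => //; exact: measurable_tuple_of_prod.
have := @ge0_integral_pushforward _ _ _ _ R _ (@measurable_tuple_of_prod R n)
  (@lebesgue_measure R \x lebesgue_tuple R n)%E setT (fun t => `|f t|%E) measurableT.
rewrite preimage_setT => <-//; exact: measurableT_comp.
Qed.

(** Both orders of integration are kept: for the integral of a partial derivative, the inner
    integral must contain the differentiated coordinate, which may be the first one or one of the
    others. *)
Lemma integral_tupleS n (f : n.+1.-tuple MR -> \bar R) :
  (lebesgue_tuple R n.+1).-integrable setT f ->
  (\int[lebesgue_tuple R n.+1]_t f t =
   \int[@lebesgue_measure R]_x \int[lebesgue_tuple R n]_t f (tuple_of_prod (x, t)))%E /\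
  (\int[lebesgue_tuple R n.+1]_t f t =
   \int[lebesgue_tuple R n]_t \int[@lebesgue_measure R]_x f (tuple_of_prod (x, t)))%E.
Proof.
move=> intf; have intf' := integrable_tupleS intf.
have mf : measurable_fun setT f by case/integrableP: intf.
have -> : (\int[lebesgue_tuple R n.+1]_t f t =
  \int[(@lebesgue_measure R \x lebesgue_tuple R n)%E]_z (f \o (@tuple_of_prod R n)) z)%E.
  transitivity (\int[pushforward (@lebesgue_measure R \x lebesgue_tuple R n)%E
    (@tuple_of_prod R n)]_t f t)%E; first by [].
  rewrite integral_pushforward// ?preimage_setT//.
  exact: measurable_tuple_of_prod.
by split; [rewrite -integral12_prod_meas1|rewrite -integral21_prod_meas1].
Qed.

Lemma tnth_tuple_of_prod0 n (x : R) (t : n.-tuple MR) :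
  tnth (tuple_of_prod (x, t)) ord0 = x.
Proof. by []. Qed.

Lemma tnth_tuple_of_prodS n (x : R) (t : n.-tuple MR) i :
  tnth (tuple_of_prod (x, t)) (lift ord0 i) = tnth t i.
Proof. by rewrite tnthS. Qed.

Lemma integral_tuple_prod n (g : 'I_n -> R -> R) (a : 'I_n -> R) :
  (forall i x, 0 <= g i x) -> (forall i, measurable_fun setT (g i)) ->
  (forall i, (\int[@lebesgue_measure R]_x (g i x)%:E = (a i)%:E)%E) ->
  (\int[lebesgue_tuple R n]_t (\prod_(i < n) g i (tnth t i))%:E =
   (\prod_(i < n) a i)%:E)%E.
Proof.
elim: n g a => [|n ih] g a g0 mg ga.
  (* In dimension 0 the measure is the Dirac mass at the empty tuple, so both sides are 1. *)
  under eq_integral do rewrite big_ord0.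
  by rewrite big_ord0 integral_dirac// diracT mul1e.
have mprod m (h : 'I_m -> R -> R) : (forall i, measurable_fun setT (h i)) ->
    measurable_fun setT (fun t : m.-tuple MR => \prod_(i < m) h i (tnth t i)).
  move=> mh; apply: measurable_prod => i _.
  exact: (measurableT_comp (mh i) (@measurable_tnth _ MR m i)).
have p0 m (h : 'I_m -> R -> R) (t : m.-tuple MR) : (forall i x, 0 <= h i x) ->
    0 <= \prod_(i < m) h i (tnth t i).
  by move=> h0; apply: prodr_ge0.
rewrite ge0_integral_tupleS; last 2 first.
- by move=> t; rewrite lee_fin p0.
- by apply/measurable_EFinP; exact: mprod.
have a0 i : 0 <= a i by rewrite -lee_fin -ga integral_ge0// => x _; rewrite lee_fin.
pose A := \prod_(i < n) a (lift ord0 i).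
have A0 : 0 <= A by exact: prodr_ge0.
have pE x (t : n.-tuple MR) :
    \prod_(i < n.+1) g i (tnth (tuple_of_prod (x, t)) i) =
    g ord0 x * \prod_(i < n) g (lift ord0 i) (tnth t i).
  rewrite big_ord_recl tnth_tuple_of_prod0; congr (_ * _).
  by apply: eq_bigr => i _; rewrite tnth_tuple_of_prodS.
transitivity (\int[@lebesgue_measure R]_x ((g ord0 x)%:E * A%:E))%E.
  apply: eq_integral => x _; under eq_integral do rewrite pE EFinM.
  rewrite ge0_integralZl_EFin//; last first.
  - by apply/measurable_EFinP; exact: (mprod _ (fun i => g (lift ord0 i))).
  - by move=> t _; rewrite lee_fin (p0 _ (fun i => g (lift ord0 i))).
  by rewrite (ih (fun i => g (lift ord0 i)) (fun i => a (lift ord0 i))).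
have mg0 : measurable_fun setT (fun x : MR => (g ord0 x)%:E).
  by apply/measurable_EFinP; exact: (mg ord0).
rewrite (ge0_integralZr _ _ mg0)//; last by move=> x _; rewrite lee_fin.
by rewrite ga big_ord_recl EFinM.
Qed.

End lebesgue_tuple_integration.

(** * Splitting off the first coordinate *)

Section slices.
Context {R : realType}.

(** The two difference quotients are the same function of [h]. This transfers partial derivatives to
    slices. *)
Lemma is_derive_affine (V W : normedModType R) (phi : V -> W) (g : W -> R)
    (a v : V) (v' : W) (dg : R) :
  (forall h : R, phi (h *: v + a) = h *: v' + phi a) ->
  is_derive (phi a) v' g dg -> is_derive a v (fun y => g (phi y)) dg.
Proof.
move=> phiE [dgx <-].
have E : (fun h : R => h^-1 *: (((fun y => g (phi y)) \o shift a) (h *: v) - g (phi a))) =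
         (fun h : R => h^-1 *: ((g \o shift (phi a)) (h *: v') - g (phi a))).
  by apply/funext => h /=; rewrite phiE.
by split; rewrite /derivable /derive E.
Qed.

(** Counterpart of [tuple_of_prod] on row vectors, where topology and derivatives live. *)
Definition row_cons n (x : R) (y : 'rV[R]_n) : 'rV[R]_n.+1 :=
  \row_i (if unlift ord0 i is Some k then y 0 k else x).

Lemma row_cons0 n x (y : 'rV[R]_n) : row_cons x y 0 ord0 = x.
Proof. by rewrite mxE unlift_none. Qed.

Lemma row_consS n x (y : 'rV[R]_n) i : row_cons x y 0 (lift ord0 i) = y 0 i.
Proof. by rewrite mxE liftK. Qed.

Lemma of_tuple_cons n x (t : n.-tuple (measurableTypeR R)) :
  of_tuple (tuple_of_prod (x, t)) = row_cons x (of_tuple t).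
Proof.
apply/rowP => i; rewrite !mxE; case: unliftP => [k ->|->].
  by rewrite tnth_tuple_of_prodS mxE.
by rewrite tnth_tuple_of_prod0.
Qed.

Lemma row_cons_shiftl n (h x : R) (y : 'rV[R]_n) :
  row_cons (h *: (1 : R) + x) y = h *: delta_mx 0 ord0 + row_cons x y.
Proof.
apply/rowP => i; rewrite !mxE; case: unliftP => [k ->|->].
  by rewrite andbF mulr0 add0r.
by rewrite eqxx mulr1 [_ *: _]mulr1.
Qed.

Lemma row_cons_shiftr n (h x : R) (y : 'rV[R]_n) j :
  row_cons x (h *: delta_mx 0 j + y) = h *: delta_mx 0 (lift ord0 j) + row_cons x y.
Proof.
apply/rowP => i; rewrite !mxE; case: unliftP => [k ->|->].
  by rewrite !mxE (inj_eq lift_inj).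
by rewrite /= mulr0 add0r.
Qed.

Lemma continuous_row_consr n (x : R) : continuous (@row_cons n x).
Proof.
move=> y A /nbhs_ballP[e e0 eA]; apply/nbhs_ballP; exists e => //= y' [_ yy'].
apply: eA; split => // i j; rewrite !mxE; case: unliftP => [k _|_]; first exact: yy'.
exact: ballxx.
Qed.

Lemma continuous_row_consl n (y : 'rV[R]_n) : continuous (fun x : R => row_cons x y).
Proof.
move=> x A /nbhs_ballP[e e0 eA]; apply/nbhs_ballP; exists e => //= x' xx'.
apply: eA; split => // i j; rewrite !mxE; case: unliftP => [k _|_] //.
exact: ballxx.
Qed.

End slices.

(** * Cubes as dominating functions *)

Section boxes.
Context {R : realType}.
Local Notation MR := (measurableTypeR R).
Local Notation leb := (@lebesgue_measure R).

(** Indicator of the closed cube of half-side [s], as a product so that its integral factors. A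
    bound [|f x| <= M * box c s x] records the size and the support of [f] together. *)
Definition box n (c : 'rV[R]_n) (s : R) (x : 'rV[R]_n) : R :=
  \prod_(i < n) \1_(`[c 0 i - s, c 0 i + s]%classic : set R) (x 0 i).

Lemma box_cons n (c : 'rV[R]_n.+1) s x (y : 'rV[R]_n) :
  box c s (row_cons x y) =
  \1_(`[c 0 ord0 - s, c 0 ord0 + s]%classic : set R) x *
  box (\row_i c 0 (lift ord0 i)) s y.
Proof.
rewrite /box big_ord_recl row_cons0; congr (_ * _); apply: eq_bigr => i _.
by rewrite row_consS mxE.
Qed.

Lemma box_ge0 n (c : 'rV[R]_n) s x : 0 <= box c s x.
Proof. exact: prodr_ge0. Qed.

Lemma boxE n (c : 'rV[R]_n) s x :
  box c s x = [forall i, `|x 0 i - c 0 i| <= s]%:R.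
Proof.
have iE i : (x 0 i \in (`[c 0 i - s, c 0 i + s]%classic : set R)) =
            (`|x 0 i - c 0 i| <= s).
  rewrite mem_setE in_itv/= ler_norml.
  by apply/andP/andP => -[h1 h2]; split; lra.
case: (boolP [forall i, _]) => [/forallP h|/forallPn[i hi]].
  by rewrite /box big1// => i _; rewrite indicE iE h.
by rewrite /box (bigD1 i)//= indicE iE (negPf hi) mul0r.
Qed.

Lemma integral_box n (c : 'rV[R]_n) s : 0 <= s ->
  (\int[lebesgue_tuple R n]_t (box c s (of_tuple t))%:E = ((2 * s) ^+ n)%:E)%E.
Proof.
move=> s0; rewrite -[X in ((_ * _) ^+ X)%:E%E](card_ord n) -prodr_const.
rewrite -(@integral_tuple_prod R n
  (fun i => \1_(`[c 0 i - s, c 0 i + s]%classic : set R)) (fun=> 2 * s)) => //.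
- by apply: eq_integral => t _; congr EFin; apply: eq_bigr => i _; rewrite mxE.
- move=> i; rewrite integral_indic// setIT.
  apply: (etrans (lebesgue_measure_itv `[c 0 i - s, c 0 i + s])); rewrite /= lte_fin.
  case: ltP => h; rewrite -?EFinB; congr EFin; lra.
Qed.

Lemma measurable_box n (c : 'rV[R]_n) s :
  measurable_fun setT (fun t : n.-tuple MR => box c s (of_tuple t)).
Proof.
rewrite /box; under eq_fun do under eq_bigr do rewrite mxE.
apply: measurable_prod => i _.
have m1 : measurable_fun setT (\1_(`[c 0 i - s, c 0 i + s]%classic : set R) : MR -> R).
  exact: measurable_indic.
exact: (measurableT_comp m1 (@measurable_tnth _ MR n i)).
Qed.

Lemma box_integrable n (c : 'rV[R]_n) (s M : R) (f : 'rV[R]_n -> R) : 0 <= s ->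
  measurable_fun setT (fun t : n.-tuple MR => f (of_tuple t)) ->
  (forall x, `|f x| <= M * box c s x) ->
  (lebesgue_tuple R n).-integrable setT (fun t => (f (of_tuple t))%:E).
Proof.
move=> s0 mf fM; apply: (@le_integrable _ _ _ _ _ _ _
  (fun t => (`|M|%:E * (box c s (of_tuple t))%:E)%E)) => //.
- exact/measurable_EFinP.
- move=> t _; rewrite /= lee_fin normrM normr_id (ger0_norm (box_ge0 _ _ _)).
  by rewrite (le_trans (fM _))// ler_wpM2r ?box_ge0 ?ler_norm.
- apply: integrableZl => //; apply/integrableP; split.
    by apply/measurable_EFinP; exact: measurable_box.
  under eq_integral do rewrite gee0_abs ?lee_fin ?box_ge0//.
  by rewrite integral_box// ltry.
Qed.

Lemma box_integral_le n (c : 'rV[R]_n) (s M : R) (f : 'rV[R]_n -> R) : 0 <= s ->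
  measurable_fun setT (fun t : n.-tuple MR => f (of_tuple t)) ->
  (forall x, `|f x| <= M * box c s x) ->
  `|\int[lebesgue_tuple R n]_t f (of_tuple t)| <= M * (2 * s) ^+ n.
Proof.
move=> s0 mf fM; have intf := box_integrable s0 mf fM.
(* Evaluation at the centre, where the cube function is 1. *)
have M0 : 0 <= M.
  have := fM c; rewrite boxE (_ : [forall i, _] = true) ?mulr1.
    exact: le_trans.
  by apply/forallP => i; rewrite subrr normr0.
rewrite (le_trans (le_normr_Rintegral _ intf))//.
rewrite -lee_fin /Rintegral fineK; last first.
  by have := integrable_abse intf => /integrable_fin_num; exact.
rewrite EFinM -(integral_box c s0).
have mb : measurable_fun setT (fun t : n.-tuple MR => (box c s (of_tuple t))%:E).
  by apply/measurable_EFinP; exact: measurable_box.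
rewrite -ge0_integralZl_EFin//; last by move=> t _; rewrite lee_fin box_ge0.
apply: ge0_le_integral => //.
- by apply/measurable_EFinP; apply: measurableT_comp.
- by apply: emeasurable_funM.
- by move=> t _; rewrite lee_fin.
Qed.

End boxes.

(** * Integrals of partial derivatives *)

Section integration_by_parts.
Context {R : realType}.
Local Notation MR := (measurableTypeR R).
Local Notation leb := (@lebesgue_measure R).

Lemma integral_derivative0 (h h' : R -> R) (a b : R) : a < b ->
  continuous h' -> (forall x : R, is_derive x (1 : R) h (h' x)) ->
  (forall x, ~~ (a < x < b) -> h x = 0) ->
  (forall x, ~~ (a < x < b) -> h' x = 0) ->
  (\int[leb]_x (h' x)%:E = 0)%E.
Proof.
move=> ab ch' dh h0 h'0.
have ch : continuous h.
  move=> x; apply/differentiable_continuous/derivable1_diffP.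
  by have [] := dh x.
have -> : (\int[leb]_x (h' x)%:E = \int[leb]_(x in `[a, b]) (h' x)%:E)%E.
  rewrite [RHS]integral_mkcond; apply: eq_integral => x _.
  rewrite patchE; case: ifPn => //; rewrite mem_setE in_itv/= => xab.
  rewrite h'0//; apply: contra xab => /andP[ax xb].
  by rewrite !ltW.
rewrite (@continuous_FTC2 R h' h a b)//.
- by rewrite !h0 ?ltxx ?andbF// subee.
- exact: continuous_subspaceT.
- split => [x _||]; first by have [] := dh x.
  + exact: cvg_at_right_filter (ch a).
  + exact: cvg_at_left_filter (ch b).
- by move=> x _; rewrite derive1E; have [] := dh x.
Qed.

(** Induction on the dimension. If [j] is not the first coordinate, freezing the first one leaves
    the same problem on each slice; if it is, the inner integral runs along the first coordinate and
    vanishes by the fundamental theorem of calculus. *)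
Lemma integral_partial0 n (j : 'I_n) (g g' : 'rV[R]_n -> R) (c : 'rV[R]_n) (s M : R) :
  0 <= s -> continuous g' ->
  (forall x, is_derive x (delta_mx 0 j) g (g' x)) ->
  (forall x, `|g' x| <= M * box c s x) ->
  (forall x, box c s x = 0 -> g x = 0) ->
  (\int[lebesgue_tuple R n]_t (g' (of_tuple t))%:E = 0)%E.
Proof.
move=> s0; elim: n j g g' c M => [[]//|n ih] j g g' c M cg' dg g'M g0.
have mg' := measurable_of_tuple cg'.
have intg' := box_integrable s0 mg' g'M.
have [int1 int2] := integral_tupleS intg'.
(* The enlargement to [s + 1] makes the function vanish at the endpoints of the interval as well and
   keeps the interval nondegenerate when [s = 0]. *)
have box_out x (y : 'rV[R]_n) :
    ~~ (c 0 ord0 - (s + 1) < x < c 0 ord0 + (s + 1)) -> box c s (row_cons x y) = 0.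
  move=> xI; rewrite box_cons indicE mem_setE in_itv/=.
  rewrite (_ : (_ <= _) && _ = false) ?mul0r//.
  apply/negbTE; apply: contra xI => /andP[h1 h2].
  by apply/andP; split; lra.
case: (unliftP ord0 j) => [k|] jE; subst j.
- rewrite int1 integral0_eq// => x _.
  pose c' := \row_i c 0 (lift ord0 i).
  transitivity (\int[lebesgue_tuple R n]_t (g' (row_cons x (of_tuple t)))%:E)%E.
    by apply: eq_integral => t _; rewrite of_tuple_cons.
  apply: (ih k (fun y => g (row_cons x y)) (fun y => g' (row_cons x y)) c' (`|M|)).
  + by move=> y; apply: continuous_comp; [exact: continuous_row_consr|exact: cg'].
  + move=> y; apply: is_derive_affine (dg (row_cons x y)) => h.
    by rewrite row_cons_shiftr.
  + move=> y; rewrite (le_trans (g'M _))// box_cons -/c' mulrA.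
    rewrite ler_wpM2r ?box_ge0// indicE.
    by case: (_ \in _) => /=; rewrite ?mulr1 ?mulr0 ?ler_norm.
  + by move=> y by0; apply: g0; rewrite box_cons -/c' by0 mulr0.
- rewrite int2 integral0_eq// => t _.
  transitivity (\int[leb]_x (g' (row_cons x (of_tuple t)))%:E)%E.
    by apply: eq_integral => x _; rewrite of_tuple_cons.
  have lt1 : c 0 ord0 - (s + 1) < c 0 ord0 + (s + 1) by lra.
  apply: (@integral_derivative0 (fun x => g (row_cons x (of_tuple t))) _ _ _ lt1).
  + by move=> x; apply: continuous_comp; [exact: continuous_row_consl|exact: cg'].
  + move=> x.
    apply: (is_derive_affine (phi := fun x : R => row_cons x (of_tuple t))) (dg _) => h.
    by rewrite row_cons_shiftl.
  + by move=> x xI; apply: g0; exact: box_out.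
  + move=> x xI; apply/eqP; rewrite -normr_le0 (le_trans (g'M _))//.
    by rewrite box_out// mulr0.
Qed.

End integration_by_parts.

(** * The Cauchy kernel *)

Section cauchy_kernel.
Context {R : realType}.
Local Notation leb := (@lebesgue_measure R).

Lemma continuous_kernel (a : R) : continuous (fun x : R => (1 + (a * x) ^+ 2)^-1).
Proof.
move=> x; apply: (@cvgV _ _ (nbhs x)).
  by rewrite gt_eqF// ltr_wpDr// sqr_ge0.
apply: cvgD; first exact: cvg_cst.
by apply: (@cvg_comp _ _ _ (fun x => a * x) (fun y => y ^+ 2) _ (nbhs (a * x)));
  [exact: mulrl_continuous|exact: exprn_continuous].
Qed.

Lemma integral_kernel (a : R) : 0 < a ->
  (\int[leb]_x ((1 + (a * x) ^+ 2)^-1)%:E = (pi / a)%:E)%E.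
Proof.
move=> a0; pose f x : R := (1 + (a * x) ^+ 2)^-1; pose F x : R := a^-1 * atan (a * x).
have f0 x : 0 <= f x by rewrite invr_ge0 addr_ge0// sqr_ge0.
have dF (x : R) : is_derive x (1 : R) F (f x).
  have h : is_derive x (1 : R) (fun y => a * y) a.
    have := is_deriveZ a (is_derive_id x (1 : R)).
    by rewrite [_ *: _]mulr1; exact.
  have h2 := is_derive_comp1 (f := fun y => a * y) (is_derive1_atan (a * x)) h.
  have h3 := is_deriveZ a^-1 h2.
  apply: (is_derive_eq h3); rewrite /f.
  by rewrite [_ *: _]mulrC -mulrA mulfV ?gt_eqF// mulr1.
have cF : continuous F.
  by move=> x; apply/differentiable_continuous/derivable1_diffP; have [] := dF x.
(* By evenness the integral is twice that over the half-line, where the primitive [F] increases from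
   0 to pi / (2 a). *)
have evf : f =1 f \o -%R by move=> x; rewrite /f /= mulrN sqrrN.
rewrite (ge0_symfun_integralT f0 (@continuous_kernel a) evf).
rewrite -set_itvcy (@ge0_continuous_FTC2y _ f F 0 (a^-1 * (pi / 2)))//.
- rewrite /F mulr0 atan0 mulr0 sube0 -EFinM; congr EFin.
  by field; rewrite gt_eqF.
- exact/continuous_subspaceT/continuous_kernel.
- apply: cvgM; first exact: cvg_cst.
  apply: (@cvg_comp _ _ _ (fun x => a * x) atan _ (pinfty_nbhs R)); last exact: cvgy_atan.
  exact: gt0_cvgMry.
- exact: cvg_at_right_filter (cF 0).
- by move=> x _; rewrite derive1E; have [] := dF x.
Qed.

End cauchy_kernel.

(** * Fourier transform and Sobolev norm *)

Section fourier_decay.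
Context {R : realType} {d : nat}.
Local Notation V := 'rV[R]_d.
Local Notation e_ j := (delta_mx 0 j : V).
Local Notation MR := (measurableTypeR R).
Implicit Types (u v : V -> R) (f : V -> R[i]) (xi c : V).

Definition phase xi (x : V) : R := - (2 * pi * dotp x xi).

Lemma phase_is_derive xi j x :
  is_derive x (e_ j) (phase xi) (- (2 * pi * xi 0 j)).
Proof.
have dd : is_derive x (e_ j) (fun y : V => dotp y xi) (xi 0 j).
  have -> : (fun y : V => dotp y xi) = \sum_(i < d) (fun y : V => y 0 i * xi 0 i).
    by apply/funext => y; rewrite /dotp fct_sumE.
  have -> : xi 0 j = \sum_(i < d) ((i == j)%:R * xi 0 i + x 0 i * 0).
    rewrite (bigD1 j)//= eqxx mul1r mulr0 addr0 big1 ?addr0// => i /negPf->.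
    by rewrite mul0r mulr0 addr0.
  apply: is_derive_sum => i.
  exact: is_deriveM1 (coord_is_derive i j x) (is_derive_cst (xi 0 i) x (e_ j)).
have h := is_deriveZ (- (2 * pi)) dd.
have -> : phase xi = - (2 * pi) \*: (fun y : V => dotp y xi).
  by apply/funext => y; rewrite /phase -mulNr.
by apply: (is_derive_eq h); rewrite -[RHS]mulNr.
Qed.

Lemma continuous_phase xi : continuous (phase xi).
Proof.
have cd : continuous (fun y : V => dotp y xi).
  apply: continuous_sum1 => i; apply: continuousM1; first exact: continuous_coord.
  exact: cst_continuous.
have -> : phase xi = fun y : V => - (2 * pi) * dotp y xi.
  by apply/funext => y; rewrite /phase mulNr.
by apply: continuousM1 => //; exact: cst_continuous.
Qed.

(** [modc] and [mods] are the real and imaginary parts of (u + i v) e^(i phase), the integrand of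
    the Fourier transform of u + i v. *)
Definition modc xi u v (x : V) : R := u x * cos (phase xi x) - v x * sin (phase xi x).
Definition mods xi u v (x : V) : R := u x * sin (phase xi x) + v x * cos (phase xi x).

Lemma fourierE f xi : fourier f xi =
  Complex (\int[lebesgue_tuple R d]_t modc xi (re f) (im f) (of_tuple t))
          (\int[lebesgue_tuple R d]_t mods xi (re f) (im f) (of_tuple t)).
Proof.
rewrite /fourier /cintegral; congr (Complex _ _); congr fine;
  apply: eq_integral => t _; rewrite /re /im /modc /mods /cis /phase;
  by case: (f _).
Qed.

Section modulation.
Variables (xi c : V) (s : R) (u v : V -> R) (M : R).
Hypothesis s0 : 0 <= s.
Hypothesis cu : continuous u.
Hypothesis cv : continuous v.
Hypothesis uM : forall x, `|u x| <= M * box c s x.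
Hypothesis vM : forall x, `|v x| <= M * box c s x.

Let cc : continuous (fun x => cos (phase xi x)).
Proof.
apply: (@continuous_comp1 _ _ cos) => [|x]; first exact: continuous_phase.
exact: continuous_cos.
Qed.

Let cs : continuous (fun x => sin (phase xi x)).
Proof.
apply: (@continuous_comp1 _ _ sin) => [|x]; first exact: continuous_phase.
exact: continuous_sin.
Qed.

Lemma continuous_modc : continuous (modc xi u v).
Proof.
have -> : modc xi u v =
    fun x => u x * cos (phase xi x) + (-1) * (v x * sin (phase xi x)).
  by apply/funext => x; rewrite mulN1r.
apply: continuousD1; first exact: continuousM1.
by apply: continuousM1; [exact: cst_continuous|exact: continuousM1].
Qed.

Lemma continuous_mods : continuous (mods xi u v).
Proof. by apply: continuousD1; exact: continuousM1. Qed.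

Let trig_le (a b p q m : R) : `|a| <= m -> `|b| <= m -> `|p| <= 1 -> `|q| <= 1 ->
  `|a * p + b * q| <= 2 * m.
Proof.
move=> am bm p1 q1; rewrite (le_trans (ler_normD _ _))// !normrM mulrDl mul1r.
by apply: lerD; rewrite -[leRHS]mulr1 ler_pM.
Qed.

Let cos1 (t : R) : `|cos t| <= 1. Proof. by rewrite ler_norml cos_geN1 cos_le1. Qed.
Let sin1 (t : R) : `|sin t| <= 1. Proof. by rewrite ler_norml sin_geN1 sin_le1. Qed.

Lemma modc_le x : `|modc xi u v x| <= 2 * M * box c s x.
Proof. by rewrite -mulrA /modc -mulrN trig_le// ?normrN. Qed.

Lemma mods_le x : `|mods xi u v x| <= 2 * M * box c s x.
Proof. by rewrite -mulrA trig_le. Qed.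

Lemma modc_integrable :
  (lebesgue_tuple R d).-integrable setT (fun t => (modc xi u v (of_tuple t))%:E).
Proof.
apply: (box_integrable s0 _ modc_le).
by apply: measurable_of_tuple; exact: continuous_modc.
Qed.

Lemma mods_integrable :
  (lebesgue_tuple R d).-integrable setT (fun t => (mods xi u v (of_tuple t))%:E).
Proof.
apply: (box_integrable s0 _ mods_le).
by apply: measurable_of_tuple; exact: continuous_mods.
Qed.

End modulation.

Lemma fourier_le f xi c (s M : R) : 0 <= s ->
  continuous (re f) -> continuous (im f) ->
  (forall x, `|re f x| <= M * box c s x) -> (forall x, `|im f x| <= M * box c s x) ->
  cabs (fourier f xi) <= 4 * M * (2 * s) ^+ d.
Proof.
move=> s0 cu cv uM vM; rewrite (le_trans (cabs_le _))// fourierE /=.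
have mc := measurable_of_tuple (continuous_modc (xi := xi) cu cv).
have ms := measurable_of_tuple (continuous_mods (xi := xi) cu cv).
have h1 := box_integral_le s0 mc (modc_le xi uM vM).
have h2 := box_integral_le s0 ms (mods_le xi uM vM).
by rewrite (le_trans (lerD h1 h2))// -mulrDl -mulrDl -natrD.
Qed.

(** The modulus of F(d_j f)(xi) = 2 pi i xi_j F(f)(xi). With [k = 2 pi xi_j], the derivatives of
    [modc xi u v] and [mods xi u v] are [modc xi u' v' + k * mods xi u v] and
    [mods xi u' v' - k * modc xi u v], and both have integral zero. *)
Lemma fourier_partial f j xi c (s M M' : R) : 0 <= s ->
  continuous (re f) -> continuous (im f) ->
  (forall x, `|re f x| <= M * box c s x) -> (forall x, `|im f x| <= M * box c s x) ->
  continuous (re (partial j f)) -> continuous (im (partial j f)) ->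
  (forall x, `|re (partial j f) x| <= M' * box c s x) ->
  (forall x, `|im (partial j f) x| <= M' * box c s x) ->
  (forall x, derivable (re f) x (e_ j) /\ derivable (im f) x (e_ j)) ->
  cabs (fourier (partial j f) xi) = 2 * pi * `|xi 0 j| * cabs (fourier f xi).
Proof.
move=> s0 cu cv uM vM cu' cv' u'M v'M df.
set u := re f in cu uM df *; set v := im f in cv vM df *.
set u' := re (partial j f) in cu' u'M *; set v' := im (partial j f) in cv' v'M *.
pose k := 2 * pi * xi 0 j.
have du x : is_derive x (e_ j) u (u' x) by exact/derivableP/(df x).1.
have dv x : is_derive x (e_ j) v (v' x) by exact/derivableP/(df x).2.
have dcos x : is_derive x (e_ j) (fun y => cos (phase xi y)) (k * sin (phase xi x)).
  have h := is_derive_comp1 (is_derive_cos (phase xi x)) (phase_is_derive xi j x).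
  by apply: (is_derive_eq h); rewrite mulrNN mulrC.
have dsin x : is_derive x (e_ j) (fun y => sin (phase xi y)) (- k * cos (phase xi x)).
  have h := is_derive_comp1 (is_derive_sin (phase xi x)) (phase_is_derive xi j x).
  by apply: (is_derive_eq h); rewrite mulrC.
have dc x : is_derive x (e_ j) (modc xi u v) (modc xi u' v' x + k * mods xi u v x).
  have h := is_deriveB (is_deriveM1 (du x) (dcos x)) (is_deriveM1 (dv x) (dsin x)).
  by apply: (is_derive_eq h); rewrite /modc /mods; ring.
have ds x : is_derive x (e_ j) (mods xi u v) (mods xi u' v' x + (- k) * modc xi u v x).
  have h := is_deriveD (is_deriveM1 (du x) (dsin x)) (is_deriveM1 (dv x) (dcos x)).
  by apply: (is_derive_eq h); rewrite /modc /mods; ring.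
have uv0 x : box c s x = 0 -> u x = 0 /\ v x = 0.
  move=> bx0; have := uM x; have := vM x; rewrite bx0 !mulr0 !normr_le0.
  by move=> /eqP -> /eqP ->.
have mod0 x : box c s x = 0 -> modc xi u v x = 0 /\ mods xi u v x = 0.
  by move=> /uv0[u0 v0]; rewrite /modc /mods u0 v0 !mul0r subr0 addr0.
have bnd (w : R) a b x : `|a| <= 2 * M' * box c s x -> `|b| <= 2 * M * box c s x ->
    `|a + w * b| <= (2 * M' + `|w| * (2 * M)) * box c s x.
  move=> h1 h2; rewrite (le_trans (ler_normD _ _))// mulrDl lerD// normrM -mulrA.
  by rewrite ler_wpM2l.
have ic := modc_integrable xi s0 cu cv uM vM.
have is_ := mods_integrable xi s0 cu cv uM vM.
have ic' := modc_integrable xi s0 cu' cv' u'M v'M.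
have is' := mods_integrable xi s0 cu' cv' u'M v'M.
have Rint0 (A B g : V -> R) (w : R) :
    (lebesgue_tuple R d).-integrable setT (fun t => (A (of_tuple t))%:E) ->
    (lebesgue_tuple R d).-integrable setT (fun t => (B (of_tuple t))%:E) ->
    continuous A -> continuous B ->
    (forall x, is_derive x (e_ j) g (A x + w * B x)) ->
    (forall x, `|A x| <= 2 * M' * box c s x) -> (forall x, `|B x| <= 2 * M * box c s x) ->
    (forall x, box c s x = 0 -> g x = 0) ->
    \int[lebesgue_tuple R d]_t A (of_tuple t) =
      - w * \int[lebesgue_tuple R d]_t B (of_tuple t).
  move=> iA iB cA cB dg AM BM g0.
  have cAB : continuous (fun x => A x + w * B x).
    by apply: continuousD1 => //; apply: continuousM1 => //; exact: cst_continuous.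
  have := integral_partial0 s0 cAB dg (fun x => bnd w _ _ x (AM x) (BM x)) g0.
  move=> /(congr1 fine); rewrite -/(Rintegral _ _ _) RintegralD//; last first.
    exact: (integrableZl measurableT w iB).
  rewrite RintegralZl//= => /eqP; rewrite addr_eq0 => /eqP ->.
  by rewrite mulNr.
have hc := Rint0 _ _ _ k ic' is_
  (continuous_modc (xi := xi) cu' cv') (continuous_mods (xi := xi) cu cv)
  dc (modc_le xi u'M v'M) (mods_le xi uM vM) (fun x h => (mod0 x h).1).
have hs := Rint0 _ _ _ (- k) is' ic
  (continuous_mods (xi := xi) cu' cv') (continuous_modc (xi := xi) cu cv)
  ds (mods_le xi u'M v'M) (modc_le xi uM vM) (fun x h => (mod0 x h).2).
rewrite !fourierE -/u -/v -/u' -/v' hc hs /cabs /= opprK.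
have sqrtE (w a b : R) :
    Num.sqrt ((- w * a) ^+ 2 + (w * b) ^+ 2) = `|w| * Num.sqrt (b ^+ 2 + a ^+ 2).
  by rewrite !exprMn sqrrN -mulrDr sqrtrM ?sqr_ge0// sqrtr_sqr addrC.
rewrite sqrtE.
by rewrite /k !normrM ger0_norm// (ger0_norm (pi_ge0 R)).
Qed.

(** The derivatives of order below [K] enter only through integrability, so their bounds [B] leave
    no trace in the result; the size comes from order [K] alone. *)
Lemma fourier_decay f j K xi c (s M : R) : 0 <= s ->
  (forall k, (k <= K)%N ->
    [/\ continuous (re (partials (nseq k j) f)),
        continuous (im (partials (nseq k j) f)) &
        exists B, (forall x, `|re (partials (nseq k j) f) x| <= B * box c s x) /\
                  (forall x, `|im (partials (nseq k j) f) x| <= B * box c s x)]) ->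
  (forall k, (k < K)%N -> forall x,
    derivable (re (partials (nseq k j) f)) x (e_ j) /\
    derivable (im (partials (nseq k j) f)) x (e_ j)) ->
  (forall x, `|re (partials (nseq K j) f) x| <= M * box c s x) ->
  (forall x, `|im (partials (nseq K j) f) x| <= M * box c s x) ->
  (2 * pi * `|xi 0 j|) ^+ K * cabs (fourier f xi) <= 4 * M * (2 * s) ^+ d.
Proof.
move=> s0 fM df uM vM.
have -> : (2 * pi * `|xi 0 j|) ^+ K * cabs (fourier f xi) =
    cabs (fourier (partials (nseq K j) f) xi).
  elim: K fM df {uM vM} => [|K ih] fM df; first by rewrite expr0 mul1r.
  have [c1 c2 [B [b1 b2]]] := fM K (leqnSn _).
  have [c1' c2' [B' [b1' b2']]] := fM K.+1 (leqnn _).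
  rewrite (fourier_partial xi s0 c1 c2 b1 b2 c1' c2' b1' b2' (df K (ltnSn _))).
  rewrite exprS -mulrA ih// => [k kK|k kK]; first by apply: fM; exact: leqW.
  by apply: df; exact: leqW.
by have [c1 c2 _] := fM K (leqnn _); exact: fourier_le.
Qed.

End fourier_decay.

Ltac nonneg := repeat first
  [ done | exact: powR_ge0 | exact: sqr_ge0 | exact: enorm_ge0 | exact: sqrtr_ge0 | exact: ltW
  | apply: exprn_ge0 | apply: mulr_ge0 | rewrite invr_ge0 ].

(** * From Fourier decay to the Sobolev norm *)

Section sobolev_norm.
Context {R : realType}.
Local Notation MR := (measurableTypeR R).

(* Unlike the library lemma [ge0_le_integral], no measurability is assumed. *)
Lemma ge0_le_integralT dd (T : measurableType dd) (mu : {measure set T -> \bar R})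
    (f g : T -> \bar R) :
  (forall x, (0 <= f x)%E) -> (forall x, (f x <= g x)%E) ->
  (\int[mu]_x f x <= \int[mu]_x g x)%E.
Proof.
move=> f0 fg; have g0 x : (0 <= g x)%E by exact: le_trans (f0 x) (fg x).
rewrite !ge0_integralTE//; apply: le_ereal_sup => _ [h hf <-].
by exists h => // x; exact: le_trans (hf x) (fg x).
Qed.

(** Of the factor [S ^ (2 (n + d))] available after squaring the decay bound, [S ^ (2 n)] absorbs
    the Sobolev weight, as [theta <= n], and [S ^ (2 d)] absorbs the inverse of the product of
    kernels. *)
Lemma Hdot_norm_le d (f : 'rV[R]_d -> R[i]) (E rho sigma theta : R) (n : nat) :
  (0 < d)%N -> 0 < rho -> 0 <= theta <= sigma -> sigma <= n%:R ->
  (forall xi : 'rV[R]_d, cabs (fourier f xi) <= E) ->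
  (forall (xi : 'rV[R]_d) j, (2 * pi * rho * `|xi 0 j|) ^+ (n + d) * cabs (fourier f xi) <= E) ->
  (Hdot_norm theta f <=
    (Num.sqrt (d%:R `^ sigma * E ^+ 2 * rho `^ (- (2 * theta)) * rho ^- d))%:E)%E.
Proof.
move=> d0 rho0 /andP[th0 th1] sn FE FKE.
have pi0 := pi_gt0 R.
pose a := 2 * pi * rho; have a0 : 0 < a by rewrite !mulr_gt0.
pose K := d%:R `^ sigma * E ^+ 2 * rho `^ (- (2 * theta)) * 2 ^+ d.
have K0 : 0 <= K by rewrite /K; nonneg.
have key (xi : 'rV[R]_d) : (2 * pi * enorm xi) `^ (2 * theta) * cabs (fourier f xi) ^+ 2 <=
    K * \prod_(j < d) (1 + (a * xi 0 j) ^+ 2)^-1.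
  set P := cabs (fourier f xi); have P0 : 0 <= P by exact: sqrtr_ge0.
  pose S := \big[Order.max/1]_(j < d) (a * `|xi 0 j|).
  have S1 : 1 <= S by exact: bigmax_ge_id.
  have S0 : 0 <= S by exact: le_trans ler01 S1.
  have Sj j : a * `|xi 0 j| <= S by exact: le_bigmax.
  (* [S] equals 1 or one of the [a * |xi_j|], so one of the two decay hypotheses applies. *)
  have SP : S ^+ (n + d) * P <= E.
    rewrite /S; elim/big_ind : _ => [|x y hx hy|j _]; last exact: FKE.
      by rewrite expr1n mul1r FE.
    by case: (leP x y).
  have q0 j : 0 < 1 + (a * xi 0 j) ^+ 2 by rewrite ltr_wpDr// sqr_ge0.
  rewrite prodfV ler_pdivlMr ?prodr_gt0//.
  have S2 : 1 <= S ^+ 2 by rewrite exprn_ege1.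
  have prodS : \prod_(j < d) (1 + (a * xi 0 j) ^+ 2) <= (2 * S ^+ 2) ^+ d.
    rewrite -[X in _ ^+ X](card_ord d) -prodr_const; apply: ler_prod => j _.
    rewrite (ltW (q0 j))//= -real_normK ?num_real// normrM (gtr0_norm a0).
    have : (a * `|xi 0 j|) ^+ 2 <= S ^+ 2.
      by rewrite lerXn2r ?nnegrE ?mulr_ge0// ltW.
    lra.
  have powS : (2 * pi * enorm xi) `^ (2 * theta) <=
      rho `^ (- (2 * theta)) * (d%:R `^ sigma * (S ^+ 2) ^+ n).
    have -> : 2 * pi * enorm xi = rho^-1 * (a * enorm xi).
      by rewrite /a; field; rewrite gt_eqF.
    have ae0 : 0 <= a * enorm xi by rewrite mulr_ge0 ?enorm_ge0// ltW.
    have r0 : 0 <= rho^-1 by rewrite invr_ge0 ltW.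
    rewrite powRM// -powR_inv1 ?(ltW rho0)// -powRrM mulN1r ler_wpM2l ?powR_ge0//.
    rewrite powRrM powR_mulrn//.
    (* Passing from the Euclidean norm to the largest coordinate produces the factor [d ^ theta],
       bounded by [d ^ sigma] to be uniform in theta. *)
    have sumS : (a * enorm xi) ^+ 2 <= d%:R * S ^+ 2.
      rewrite exprMn enormE /dotp mulr_sumr mulr_natl -[in leRHS](card_ord d) -sumr_const.
      apply: ler_sum => j _; rewrite -expr2 -exprMn -real_normK ?num_real//.
      by rewrite normrM (gtr0_norm a0) lerXn2r ?nnegrE ?mulr_ge0// ltW.
    have d1 : 1 <= d%:R :> R by rewrite ler1n.
    apply: (@le_trans _ _ ((d%:R * S ^+ 2) `^ theta)).
      by apply: ge0_ler_powR => //; rewrite nnegrE; nonneg.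
    rewrite powRM ?sqr_ge0//.
    apply: ler_pM; [exact: powR_ge0|exact: powR_ge0|exact: ler_powR|].
    rewrite -(powR_mulrn n (sqr_ge0 S)); apply: ler_powR => //.
    exact: le_trans sn.
  have P2 : (S ^+ (n + d) * P) ^+ 2 <= E ^+ 2.
    by rewrite lerXn2r ?nnegrE ?mulr_ge0 ?exprn_ge0// (le_trans P0 (FE xi)).
  apply: (@le_trans _ _ (rho `^ (- (2 * theta)) * (d%:R `^ sigma * (S ^+ 2) ^+ n) *
      P ^+ 2 * (2 * S ^+ 2) ^+ d)).
    apply: ler_pM => //; first by rewrite mulr_ge0 ?powR_ge0 ?sqr_ge0.
      by apply: prodr_ge0 => j _; rewrite ltW.
    by rewrite ler_wpM2r ?sqr_ge0.
  have -> : rho `^ (- (2 * theta)) * (d%:R `^ sigma * (S ^+ 2) ^+ n) * P ^+ 2 *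
      (2 * S ^+ 2) ^+ d =
      (d%:R `^ sigma * rho `^ (- (2 * theta)) * 2 ^+ d) * (S ^+ (n + d) * P) ^+ 2.
    rewrite (exprMn d 2) (exprAC S 2 n) (exprAC S 2 d) exprD.
    by move: (S ^+ n) (S ^+ d) (2 ^+ d) => ? ? ?; ring.
  have -> : K = (d%:R `^ sigma * rho `^ (- (2 * theta)) * 2 ^+ d) * E ^+ 2.
    by rewrite /K; ring.
  by rewrite ler_wpM2l//; nonneg.
rewrite /Hdot_norm -powR12_sqrt; last first.
  by nonneg.
rewrite -poweR_EFin.
set I := (\int[_]_t _)%E.
have I0 : (0 <= I)%E.
  by apply: integral_ge0 => t _; rewrite lee_fin mulr_ge0 ?powR_ge0 ?sqr_ge0.
have kernel_prod : (\int[lebesgue_tuple R d]_t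
    (\prod_(j < d) (1 + (a * tnth t j) ^+ 2)^-1)%:E = ((pi / a) ^+ d)%:E)%E.
  rewrite (@integral_tuple_prod R d (fun _ x => (1 + (a * x) ^+ 2)^-1) (fun=> pi / a)).
  - by rewrite prodr_const card_ord.
  - by move=> _ x; rewrite invr_ge0 addr_ge0 ?sqr_ge0.
  - by move=> _; apply: continuous_measurable_fun; exact: continuous_kernel.
  - by move=> _; exact: integral_kernel.
apply: gt0_ler_poweR => //.
- by rewrite in_itv/= leey andbT.
- rewrite in_itv/= leey andbT lee_fin.
  by nonneg.
have mk : measurable_fun setT (fun t : d.-tuple MR =>
    (\prod_(j < d) (1 + (a * tnth t j) ^+ 2)^-1)%:E).
  apply/measurable_EFinP; apply: measurable_prod => j _.
  have mk1 := continuous_measurable_fun (@continuous_kernel R a).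
  exact: (measurableT_comp mk1 (@measurable_tnth _ MR d j)).
have kprod0 (t : d.-tuple MR) : 0 <= \prod_(j < d) (1 + (a * tnth t j) ^+ 2)^-1.
  by apply: prodr_ge0 => j _; rewrite invr_ge0 addr_ge0 ?sqr_ge0.
apply: (@le_trans _ _ (\int[lebesgue_tuple R d]_t
    (K%:E * (\prod_(j < d) (1 + (a * tnth t j) ^+ 2)^-1)%:E))%E).
  apply: ge0_le_integralT => t; first by rewrite lee_fin mulr_ge0 ?powR_ge0 ?sqr_ge0.
  rewrite -EFinM lee_fin; have := key (of_tuple t).
  by under eq_bigr do rewrite mxE.
rewrite ge0_integralZl_EFin//; last by move=> t _; rewrite lee_fin.
rewrite [X in (_ * X)%E](_ : _ = ((pi / a) ^+ d)%:E); last exact: kernel_prod.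
rewrite -EFinM lee_fin /K /a.
rewrite le_eqVlt; apply/orP; left; apply/eqP.
(* The factor [2 ^ d] in [K] cancels the one in [(2 rho) ^ d]. *)
have -> : pi / (2 * pi * rho) = (2 * rho)^-1.
  have := lt0r_neq0 pi0; move: (pi : R) => p p0; have r0 := lt0r_neq0 rho0.
  by field; rewrite r0 p0.
rewrite exprVn exprMn invfM -[LHS]mulrA; congr (_ * _).
by rewrite mulrA mulfV ?mul1r// expf_neq0.
Qed.

End sobolev_norm.

(** * Euclidean balls and their volume *)

Section balls.
Context {R : realType} {d : nat}.
Local Notation V := 'rV[R]_d.
Local Notation MR := (measurableTypeR R).
Implicit Types (x y c : V).

(** Cauchy-Schwarz, by summing [(x_i |y| - y_i |x|)^2 >= 0] over [i] and dividing by [|x| |y|];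
    hence the separate degenerate cases. *)
Lemma dotp_le x y : dotp x y <= enorm x * enorm y.
Proof.
set N := enorm x; set M := enorm y.
have [N0|N0] := eqVneq N 0.
  rewrite N0 mul0r /dotp big1// => i _.
  have := coord_le_enorm x i; rewrite -/N N0 normr_le0 => /eqP ->.
  by rewrite mul0r.
have [M0|M0] := eqVneq M 0.
  rewrite M0 mulr0 /dotp big1// => i _.
  have := coord_le_enorm y i; rewrite -/M M0 normr_le0 => /eqP ->.
  by rewrite mulr0.
have NM0 : 0 < N * M by rewrite mulr_gt0// lt_neqAle eq_sym ?N0 ?M0 enorm_ge0.
have : \sum_i (2 * (N * M)) * (x 0 i * y 0 i) <=
       \sum_i (M ^+ 2 * (x 0 i * x 0 i) + N ^+ 2 * (y 0 i * y 0 i)).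
  apply: ler_sum => i _; have := sqr_ge0 (x 0 i * M - y 0 i * N); nra.
rewrite -mulr_sumr big_split/= -!mulr_sumr -!/(dotp _ _) -!enormE -/N -/M.
by move=> h; rewrite -(ler_pM2l NM0); lra.
Qed.

Lemma enormD x y : enorm (x + y) <= enorm x + enorm y.
Proof.
rewrite -(@ler_pXn2r _ 2) ?nnegrE ?addr_ge0 ?enorm_ge0//.
have -> : enorm (x + y) ^+ 2 = enorm x ^+ 2 + 2 * dotp x y + enorm y ^+ 2.
  rewrite !enormE /dotp mulr_sumr -!big_split/=; apply: eq_bigr => i _.
  by rewrite !mxE; ring.
by have := dotp_le x y; lra.
Qed.

Lemma enormN x : enorm (- x) = enorm x.
Proof. by congr Num.sqrt; apply: eq_bigr => i _; rewrite !mxE mulrNN. Qed.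

Lemma enorm0 : enorm (0 : V) = 0.
Proof. by rewrite /enorm /dotp big1 ?sqrtr0// => i _; rewrite mxE mul0r. Qed.

Lemma eball_center c (r : R) : 0 < r -> eball c r c.
Proof. by move=> r0; rewrite /eball /= subrr enorm0. Qed.

Lemma dist0_eball c (r : R) : 0 < r ->
  enorm c - r <= dist0 (eball c r) <= enorm c.
Proof.
move=> r0; apply/andP; split.
  apply: lb_le_inf; first by exists (enorm c), c => //; exact: eball_center.
  move=> _ [x xB <-]; have : enorm (x - c) < r by [].
  have := enormD x (- (x - c)); rewrite enormN opprB addrC subrK; lra.
apply: ge_inf; first by exists 0 => _ [x _ <-]; exact: enorm_ge0.
by exists c => //; exact: eball_center.
Qed.

(** The volume enters the condition with exponent -1/2, which calls for a lower bound, given by an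
    inscribed cube. A circumscribed cube shows that the volume is finite. *)
Lemma vol_eball c (r : R) : (0 < d)%N -> 0 < r ->
  exists2 v : R, vol (eball c r) = v%:E & (r / d%:R) ^+ d <= v.
Proof.
(* With this half-side, points of the cube satisfy |x - c|^2 <= d s^2 = r^2 / (4 d) < r^2, and the
   side is r / d. *)
move=> d0 r0; pose s := r / (2 * d%:R).
have dR0 : 0 < d%:R :> R by rewrite ltr0n.
have s0 : 0 < s by rewrite divr_gt0// mulr_gt0.
have cdist : continuous (fun x : V => enorm (x - c)).
  have -> : (fun x : V => enorm (x - c)) = fun x => Num.sqrt (dotp (x - c) (x - c)) by [].
  apply: (@continuous_comp1 _ _ Num.sqrt) => [|x]; last exact: sqrt_continuous.
  have ci i : continuous (fun x : V => (x - c) 0 i).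
    have -> : (fun x : V => (x - c) 0 i) = fun x => x 0 i + (- c 0 i).
      by apply/funext => x; rewrite !mxE.
    by apply: continuousD1; [exact: continuous_coord|exact: cst_continuous].
  by apply: continuous_sum1 => i; exact: continuousM1.
have mball : measurable (of_tuple @^-1` eball c r : set (d.-tuple MR)).
  rewrite -[X in measurable X]setTI.
  have : measurable_fun setT (fun t : d.-tuple MR => enorm (of_tuple t - c) < r).
    by apply: measurable_fun_ltr => //; exact: (measurable_of_tuple cdist).
  by move=> /(_ measurableT [set true]); apply.
have volE : vol (eball c r) =
    (\int[lebesgue_tuple R d]_t (\1_(of_tuple @^-1` eball c r) t)%:E)%E.
  by rewrite integral_indic// setIT.
have lo : (((2 * s) ^+ d)%:E <= vol (eball c r))%E.
  rewrite -(integral_box c (ltW s0)) volE.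
  apply: ge0_le_integralT => t; first by rewrite lee_fin box_ge0.
  rewrite lee_fin boxE indicE; case: (boolP [forall _, _]) => [/forallP h|_] //.
  rewrite mem_set//= /eball /= -(@ltr_pXn2r _ 2) ?nnegrE ?enorm_ge0 ?(ltW r0)//.
  rewrite enormE /dotp; apply: (@le_lt_trans _ _ (\sum_(i < d) s ^+ 2)).
    apply: ler_sum => i _; rewrite !mxE -expr2 -real_normK ?num_real//.
    by rewrite lerXn2r ?nnegrE ?(ltW s0)//; have := h i; rewrite mxE.
  rewrite sumr_const card_ord -mulr_natl /s exprMn exprVn exprMn.
  rewrite mulrCA gtr_pMr ?exprn_gt0//.
  rewrite ltr_pdivrMr ?mulr_gt0 ?exprn_gt0// mul1r expr2.
  have : 1 <= d%:R :> R by rewrite ler1n.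
  nra.
have hi : (vol (eball c r) <= ((2 * r) ^+ d)%:E)%E.
  rewrite -(integral_box c (ltW r0)) volE.
  apply: ge0_le_integralT => t; first by rewrite lee_fin.
  rewrite lee_fin boxE indicE; case: (boolP (_ \in _)) => [/set_mem tB|_]; last first.
    by rewrite ler0n.
  rewrite (_ : [forall _, _] = true)//; apply/forallP => i.
  have := coord_le_enorm (of_tuple t - c) i; rewrite !mxE => h.
  by rewrite (le_trans h)// ltW.
have vfin : vol (eball c r) \is a fin_num.
  rewrite ge0_fin_numE; first exact: le_lt_trans hi (ltry _).
  by apply: le_trans lo; rewrite lee_fin exprn_ge0// mulr_ge0// ltW.
exists (fine (vol (eball c r))); first by rewrite fineK.
rewrite -lee_fin fineK//; apply: le_trans lo.
by rewrite (_ : 2 * s = r / d%:R)// /s; field; rewrite gt_eqF.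
Qed.

End balls.

(** * The Miyachi condition *)

Section pure_derivatives.
Context {R : realType} {d : nat}.
Local Notation V := 'rV[R]_d.
Local Notation e_ j := (delta_mx 0 j : V).
Implicit Types (f : V -> R[i]).

Definition pure_nu (j : 'I_d) (k : nat) : {ffun 'I_d -> nat} :=
  [ffun i => if i == j then k else 0%N].

Lemma mlen_pure j k : mlen (pure_nu j k) = k.
Proof.
rewrite /mlen (bigD1 j)//= ffunE eqxx big1 ?addn0// => i /negPf ij.
by rewrite ffunE ij.
Qed.

(** Translates the bump hypothesis, stated with multi-indices, into the iterated derivatives that
    integration by parts uses. In the concatenated list only the block of [j] can be nonempty. *)
Lemma mderiv_pure j k f : mderiv (pure_nu j k) f = partials (nseq k j) f.
Proof.
rewrite /mderiv; congr partials.
have flat0 (s : seq 'I_d) : j \notin s ->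
    flatten [seq nseq (pure_nu j k i) i | i <- s] = [::].
  elim: s => //= i s ih; rewrite inE negb_or => /andP[ji /ih ->].
  by rewrite ffunE eq_sym (negPf ji).
have : j \in enum 'I_d by rewrite mem_enum.
elim: (enum 'I_d) (enum_uniq 'I_d) => //= i s ih /andP[is_ us].
rewrite inE ffunE; case: eqVneq => [ij _|ij /= js].
  by rewrite -ij flat0 ?cats0// ij.
exact: ih.
Qed.

Lemma re_le_cabs (z : R[i]) : `|complex.Re z| <= cabs z.
Proof.
by case: z => a b; rewrite /cabs /= -sqrtr_sqr ler_wsqrtr// lerDl sqr_ge0.
Qed.

Lemma im_le_cabs (z : R[i]) : `|complex.Im z| <= cabs z.
Proof.
by case: z => a b; rewrite /cabs /= -sqrtr_sqr ler_wsqrtr// lerDr sqr_ge0.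
Qed.

(** The complement of [S] is open, so each successive derivative is taken of a function vanishing
    near the point. *)
Lemma partials_out (S : set V) f s : closed S -> (forall y, ~ S y -> f y = 0) ->
  forall y, ~ S y -> re (partials s f) y = 0 /\ im (partials s f) y = 0.
Proof.
move=> cS f0; elim: s => [|j s ih] y Sy.
  by rewrite /re /im /= f0.
split.
- have h := derive_out (e_ j) cS (fun y h => (ih y h).1) Sy.
  by have [_] := h.
- have h := derive_out (e_ j) cS (fun y h => (ih y h).2) Sy.
  by have [_] := h.
Qed.

End pure_derivatives.

(** * Estimates uniform over all balls and bumps *)

Section miyachi_condition.
Context {R : realType} {d : nat} (gamma c0 C0 C1 : R).
Hypothesis d0 : (0 < d)%N.
Hypothesis gamma1 : 1 < gamma.
Hypothesis c0_gt0 : 0 < c0.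
Hypothesis c0C0 : c0 < C0.
Hypothesis C1_gt0 : 0 < C1.
Local Notation V := 'rV[R]_d.
Local Notation e_ j := (delta_mx 0 j : V).

(** The first summand gives [RB / 2 >= e^2], so that supports lie in the high-frequency region. The
    second gives (ln RB)^(gamma - 1) >= 2 (1 + C1) C0, which makes [(1 + C1) * r] at most
    [RB / 2]. *)
Definition Rstar : R :=
  2 * expR 2 + expR ((2 * (1 + C1) * C0) `^ (gamma - 1)^-1).

Lemma Rstar_ge : expR 2 <= Rstar.
Proof.
rewrite /Rstar; have := expR_gt0 (2 : R).
by have := expR_ge0 ((2 * (1 + C1) * C0) `^ (gamma - 1)^-1); lra.
Qed.

Let C0_gt0 : 0 < C0. Proof. exact: lt_trans c0C0. Qed.

Section geometry.
Variables (R0 : R) (c : V) (r : R).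
Hypothesis R0_ge : Rstar <= R0.
Hypothesis subd : log_subdyadic gamma R0 c0 C0 c r.
Let RB := dist0 (eball c r).
Let rh := rho gamma RB.

Lemma RB_ge : 2 * expR 2 <= RB.
Proof.
case: subd => _ h _ _; apply: le_trans h; apply: le_trans R0_ge.
by rewrite /Rstar lerDl expR_ge0.
Qed.

Lemma RB_gt0 : 0 < RB.
Proof. by apply: lt_le_trans RB_ge; rewrite mulr_gt0 ?expR_gt0. Qed.

Lemma lnRB_ge2 : 2 <= ln RB.
Proof.
rewrite -[leLHS](@expRK R) ler_ln ?posrE ?expR_gt0 ?RB_gt0//.
by apply: le_trans RB_ge; have := expR_gt0 (2 : R); lra.
Qed.

Lemma rh_gt0 : 0 < rh.
Proof.
by rewrite divr_gt0 ?RB_gt0// powR_gt0// (lt_le_trans _ lnRB_ge2).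
Qed.

Lemma radius_le : (1 + C1) * r <= RB / 2.
Proof.
case: (subd) => r0 hR _; rewrite -/RB => hr.
set T := (2 * (1 + C1) * C0) `^ (gamma - 1)^-1.
have g0 : 0 < gamma - 1 by rewrite subr_gt0.
have K0 : 0 < 2 * (1 + C1) * C0 by rewrite !mulr_gt0// addr_gt0.
have lT : T <= ln RB.
  rewrite -[leLHS](@expRK R) ler_ln ?posrE ?expR_gt0 ?RB_gt0//.
  apply: le_trans hR; apply: le_trans R0_ge.
  by rewrite /Rstar lerDr mulr_ge0 ?expR_ge0.
have l0 : 0 < ln RB := lt_le_trans (ltr0n R 2) lnRB_ge2.
have TE : T `^ (gamma - 1) = 2 * (1 + C1) * C0.
  by rewrite /T -powRrM mulVf ?gt_eqF// powRr1// ltW.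
have : T `^ (gamma - 1) <= ln RB `^ (gamma - 1).
  by apply: ge0_ler_powR; rewrite ?nnegrE ?powR_ge0// ltW.
rewrite TE => h.
apply: (@le_trans _ _ ((1 + C1) * (C0 * rh))).
  by rewrite ler_wpM2l// addr_ge0// ltW.
rewrite /rh /rho !mulrA ler_pdivrMr ?powR_gt0//.
have := ler_wpM2l (ltW RB_gt0) h; lra.
Qed.

(** The distance from [x] to the centre is below [C1 * r], and [RB <= |c| <= RB + r]; together these
    account for the factor [1 + C1] in [radius_le]. *)
Lemma annulus x : eball c (C1 * r) x -> RB / 2 <= enorm x <= 2 * RB.
Proof.
case: (subd) => r0 _ _ _; rewrite /eball/= => xc.
have /andP[h1 h2] := dist0_eball c r0; rewrite -/RB in h1 h2.
have h3 := enormD x (- (x - c)); rewrite enormN opprB addrC subrK in h3.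
have h4 := enormD c (x - c); rewrite addrC subrK in h4.
have h5 := radius_le; have h6 : 0 < C1 * r by rewrite mulr_gt0.
have h7 := RB_gt0.
by apply/andP; split; lra.
Qed.

Lemma annulus_hf x : eball c (C1 * r) x -> expR 2 <= enorm x.
Proof. by move=> /annulus/andP[+ _]; apply: le_trans; have := RB_ge; lra. Qed.

(** Changing [|x|] by a factor 2 shifts the logarithm by at most ln 2 <= 1, and [ln RB >= 2] absorbs
    the shift. *)
Lemma annulus_ln x : eball c (C1 * r) x ->
  2^-1 * ln RB <= ln (enorm x) <= 2 * ln RB.
Proof.
move=> Dx; have /andP[h1 h2] := annulus Dx; have R0' := RB_gt0.
have x0 : 0 < enorm x by apply: lt_le_trans h1; rewrite divr_gt0.
have ln2 : ln 2 <= 1 :> R.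
  rewrite -[leRHS](@expRK R) ler_ln ?posrE ?expR_gt0//.
  by have := expR_ge1Dx (1 : R); lra.
have l2 := lnRB_ge2.
have l1 : ln RB - ln 2 <= ln (enorm x).
  by rewrite -ln_div ?posrE// ler_ln ?posrE// divr_gt0.
have l3 : ln (enorm x) <= ln 2 + ln RB.
  by rewrite -lnM ?posrE// ler_ln ?posrE// mulr_gt0.
by apply/andP; split; lra.
Qed.

Lemma weight_le a x : eball c (C1 * r) x ->
  ln (enorm x) `^ a <= 2 `^ `|a| * ln RB `^ a.
Proof.
move=> Dx; apply: powR_comparable; first lra.
  exact: lt_le_trans lnRB_ge2.
exact: annulus_ln.
Qed.

Lemma kap_le x : eball c (C1 * r) x ->
  ln (enorm x) `^ (gamma - 1) / enorm x <= 2 `^ `|gamma - 1| * 2 * rh^-1.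
Proof.
move=> Dx; have /andP[h1 _] := annulus Dx; have R0' := RB_gt0.
have x0 : 0 < enorm x by apply: lt_le_trans h1; rewrite divr_gt0.
rewrite /rh /rho invf_div.
have -> : 2 `^ `|gamma - 1| * 2 * (ln RB `^ (gamma - 1) / RB) =
    2 `^ `|gamma - 1| * ln RB `^ (gamma - 1) * (2 / RB) by ring.
apply: ler_pM; [exact: powR_ge0|by rewrite invr_ge0 enorm_ge0|exact: weight_le|].
by rewrite -[2 / RB]invf_div lef_pV2 ?posrE// divr_gt0.
Qed.

End geometry.

Section family.
Variables (R0 beta : R) (N : nat) (Cnu : {ffun 'I_d -> nat} -> R).
Hypothesis R0_ge : Rstar <= R0.

(** All admissible triples of centre, radius and bump form the index type, so a constant of [symb]
    cannot depend on any of them. *)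
Definition bump_family : Type := {p : V * R * (V -> R[i]) |
  log_subdyadic gamma R0 c0 C0 p.1.1 p.1.2 /\ adapted_bump C1 N Cnu p.1.1 p.1.2 p.2}.

Definition ctr (i : bump_family) : V := (sval i).1.1.
Definition rad (i : bump_family) : R := (sval i).1.2.
Definition bump (i : bump_family) : V -> R[i] := (sval i).2.
Definition rball (i : bump_family) : R := dist0 (eball (ctr i) (rad i)).
Definition scl (i : bump_family) : R := rho gamma (rball i).
Definition dom (i : bump_family) : set V := eball (ctr i) (C1 * rad i).
Definition prodf (i : bump_family) : V -> R[i] := fun x => msym gamma beta x * bump i x.

Let subd i : log_subdyadic gamma R0 c0 C0 (ctr i) (rad i) := (svalP i).1.
Let adap i : adapted_bump C1 N Cnu (ctr i) (rad i) (bump i) := (svalP i).2.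

Let kapF (i : bump_family) (x : V) : R := (scl i)^-1.
Let wF (i : bump_family) (x : V) : R := ln (rball i) `^ (- beta).

Lemma scl_gt0 i : 0 < scl i.
Proof. exact: rh_gt0 R0_ge (subd i). Qed.

Let kapF0 i x : dom i x -> 0 <= kapF i x.
Proof. by move=> _; rewrite invr_ge0 ltW// scl_gt0. Qed.

(** On the dilated balls the weights in [x] are comparable with their values at the scale [rball i],
    by constants depending only on beta and gamma. *)
Lemma symb_msym_family j n :
  symb dom kapF (pred1 j) n wF (fun _ => re (msym gamma beta)) /\
  symb dom kapF (pred1 j) n wF (fun _ => im (msym gamma beta)).
Proof.
have [sr si] := @symb_msym R d gamma gamma1 n beta.
have pull f : symb (fun _ : unit => [set x : V | expR 2 <= enorm x])
     (fun _ x => ln (enorm x) `^ (gamma - 1) / enorm x) predT n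
     (fun _ x => ln (enorm x) `^ (- beta)) (fun _ => f) ->
   symb dom kapF (pred1 j) n wF (fun _ => f).
  move=> sf.
  apply: (@symb_pull _ _ _ _ _ _ _ _ _ _ _ _ _ _ (fun _ => tt)
    (2 `^ `|- beta|) (2 `^ `|gamma - 1| * 2) _ _ _ _ sf) => //.
  - by move=> i x; exact: annulus_hf R0_ge (subd i) x.
  - by move=> i x Dx; rewrite powR_ge0/=; exact: (weight_le R0_ge (subd i)).
  - move=> i x Dx; rewrite divr_ge0 ?powR_ge0 ?enorm_ge0//=.
    exact: (kap_le R0_ge (subd i)).
by split; exact: pull.
Qed.

Lemma symb_bump_family j n : (n <= N)%N ->
  symb dom kapF (pred1 j) n (fun _ _ => 1) (fun i => re (bump i)) /\
  symb dom kapF (pred1 j) n (fun _ _ => 1) (fun i => im (bump i)).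
Proof.
move=> nN.
have bnd k : (k <= N)%N -> exists C : R, forall i x, dom i x ->
    cabs (partials (nseq k j) (bump i) x) <= C * (scl i)^-1 ^+ k.
  (* The lower bound on the radius turns [r ^- k] into [(c0 * rho) ^- k]. *)
  move=> kN; exists (`|Cnu (pure_nu j k)| * (c0^-1) ^+ k) => i x Dx.
  have [_ _ _ bN] := adap i; have [r0 _ cr _] := subd i.
  have := bN (pure_nu j k); rewrite mlen_pure mderiv_pure => /(_ kN x) h.
  rewrite (le_trans h)// (@le_trans _ _ (`|Cnu (pure_nu j k)| * rad i ^- k))//.
    by rewrite ler_wpM2r ?ler_norm// invr_ge0 exprn_ge0// ltW.
  rewrite -mulrA ler_wpM2l// -exprMn -exprVn lerXn2r ?nnegrE ?invr_ge0 ?(ltW r0)//.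
    by rewrite mulr_ge0// invr_ge0 ltW// scl_gt0.
  by rewrite -invfM lef_pV2 ?posrE// mulr_gt0// scl_gt0.
(* Generalised to the k-th derivative of the bump: [k] derivatives are already taken, [m] remain,
   and their total must stay within the [N] orders that the hypothesis controls. *)
suff H m k : (k + m <= N)%N ->
    symb dom kapF (pred1 j) m (fun i _ => (scl i)^-1 ^+ k)
      (fun i => re (partials (nseq k j) (bump i))) /\
    symb dom kapF (pred1 j) m (fun i _ => (scl i)^-1 ^+ k)
      (fun i => im (partials (nseq k j) (bump i))) by exact: (H n 0%N).
elim: m k => [|m ih] k kmN.
  have kN : (k <= N)%N by rewrite addn0 in kmN.
  have [C HC] := bnd k kN.
  split; split => //.
  - by move=> i; have [sm _ _ _] := adap i; have [] := sm (nseq k j).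
  - by exists C => i x Dx; rewrite (le_trans _ (HC i x Dx))// re_le_cabs.
  - by move=> i; have [sm _ _ _] := adap i; have [] := sm (nseq k j).
  - by exists C => i x Dx; rewrite (le_trans _ (HC i x Dx))// im_le_cabs.
have kN : (k <= N)%N by rewrite (leq_trans _ kmN)// leq_addr.
have [C HC] := bnd k kN.
have [ihr ihi] : _ /\ _ := ih k.+1 (eq_ind _ (fun m => (m <= N)%N) kmN _ (addnS _ _)).
have wE (i : bump_family) (x : V) : (scl i)^-1 ^+ k.+1 = (scl i)^-1 ^+ k * kapF i x.
  by rewrite exprSr.
split; split.
- by move=> i; have [sm _ _ _] := adap i; have [] := sm (nseq k j).
- by exists C => i x Dx; rewrite (le_trans _ (HC i x Dx))// re_le_cabs.
- move=> j' /eqP ->; split.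
    by move=> i x; have [sm _ _ _] := adap i; have [_ _ /(_ j x)[]] := sm (nseq k j).
  exact: symb_eqw wE ihr.
- by move=> i; have [sm _ _ _] := adap i; have [] := sm (nseq k j).
- by exists C => i x Dx; rewrite (le_trans _ (HC i x Dx))// im_le_cabs.
- move=> j' /eqP ->; split.
    by move=> i x; have [sm _ _ _] := adap i; have [_ _ /(_ j x)[]] := sm (nseq k j).
  exact: symb_eqw wE ihi.
Qed.

Lemma symb_prod_family j n : (n <= N)%N ->
  symb dom kapF (pred1 j) n wF (fun i => re (prodf i)) /\
  symb dom kapF (pred1 j) n wF (fun i => im (prodf i)).
Proof.
move=> nN; have [mr mi] := symb_msym_family j n; have [br bi] := symb_bump_family j nN.
have w0 i x : dom i x -> 0 <= wF i x by rewrite powR_ge0.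
have wE i x : wF i x * 1 = wF i x by rewrite mulr1.
have sM f g : symb dom kapF (pred1 j) n wF f ->
    symb dom kapF (pred1 j) n (fun _ _ => 1) g ->
    symb dom kapF (pred1 j) n wF (fun i x => f i x * g i x).
  by move=> sf sg; apply: (symb_eqw wE); apply: symb_mul.
split.
- apply: (symb_eqf (f := fun i x => re (msym gamma beta) x * re (bump i) x +
      (-1) * (im (msym gamma beta) x * im (bump i) x))).
    move=> i x; rewrite /re /im /prodf mulN1r.
    by case: (msym _ _ _) => a b; case: (bump _ _).
  apply: symb_add; first exact: (sM _ _ mr br).
  by apply: symb_scale; exact: (sM _ _ mi bi).
- apply: (symb_eqf (f := fun i x => re (msym gamma beta) x * im (bump i) x +
      im (msym gamma beta) x * re (bump i) x)).
    move=> i x; rewrite /re /im /prodf.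
    by case: (msym _ _ _) => a b; case: (bump _ _).
  by apply: symb_add; [exact: (sM _ _ mr bi)|exact: (sM _ _ mi br)].
Qed.

(** Inside the dilated ball the class gives the bound, and the ball lies in the cube; outside it
    every derivative vanishes, the support of the bump being closed. *)
Lemma prodf_box j k : (k <= N)%N -> exists2 B : R, 0 <= B & forall i x,
  `|re (partials (nseq k j) (prodf i)) x| <=
     B * ln (rball i) `^ (- beta) * scl i ^- k * box (ctr i) (C1 * rad i) x /\
  `|im (partials (nseq k j) (prodf i)) x| <=
     B * ln (rball i) `^ (- beta) * scl i ^- k * box (ctr i) (C1 * rad i) x.
Proof.
move=> kN; have [pr pi_] := symb_prod_family j kN.
have aJ : all (pred1 j) (nseq k j) by rewrite all_nseq /= eqxx orbT.
have sk : (size (nseq k j) <= k)%N by rewrite size_nseq.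
have := symb_iter pr aJ sk; have := symb_iter pi_ aJ sk.
rewrite size_nseq subnn => -[_ [Ci hi] _] [_ [Cr hr] _].
exists (`|Cr| + `|Ci|); first by rewrite addr_ge0.
move=> i x; have [x_in|x_out] := pselect (dom i x); last first.
  have [sm _ supp_ball _] := adap i.
  have z : forall y, ~ supp (bump i) y -> prodf i y = 0.
    move=> y ys; rewrite /prodf; have -> : bump i y = 0; last by rewrite mulr0.
    by apply/eqP; apply: contra_notT ys => /= yn0; apply: subset_closure.
  have [] := @partials_out R d (supp (bump i)) (prodf i) (nseq k j) (@closed_closure _ _) z x _.
    by move=> /supp_ball.
  have b0 : 0 <= (`|Cr| + `|Ci|) * ln (rball i) `^ (- beta) * scl i ^- k *
      box (ctr i) (C1 * rad i) x.
    have s0 := scl_gt0 i; apply: mulr_ge0; last exact: box_ge0.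
    by nonneg; rewrite addr_ge0.
  by move=> -> ->; rewrite normr0.
have box1 : box (ctr i) (C1 * rad i) x = 1.
  rewrite boxE (_ : [forall _, _] = true)//; apply/forallP => l.
  have := coord_le_enorm (x - ctr i) l; rewrite !mxE => h.
  by rewrite (le_trans h)// ltW.
rewrite box1 mulr1.
have wk0 : 0 <= ln (rball i) `^ (- beta) * scl i ^- k.
  by rewrite mulr_ge0 ?powR_ge0// invr_ge0 exprn_ge0// ltW// scl_gt0.
have bb (C C' a : R) : `|a| <= C * (ln (rball i) `^ (- beta) * (scl i)^-1 ^+ k) ->
    `|C| <= C' -> `|a| <= C' * ln (rball i) `^ (- beta) * scl i ^- k.
  move=> ha CC; rewrite (le_trans ha)// -mulrA exprVn ler_wpM2r//.
  exact: le_trans (ler_norm _) CC.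
rewrite re_partials im_partials; split.
- by apply: (bb Cr); [exact: (hr i x x_in)|rewrite lerDl].
- by apply: (bb Ci); [exact: (hi i x x_in)|rewrite lerDr].
Qed.

Lemma prodf_regular j k : (k <= N)%N -> forall i,
  [/\ continuous (re (partials (nseq k j) (prodf i))),
      continuous (im (partials (nseq k j) (prodf i))) &
      (k < N)%N -> forall x,
        derivable (re (partials (nseq k j) (prodf i))) x (e_ j) /\
        derivable (im (partials (nseq k j) (prodf i))) x (e_ j)].
Proof.
move=> kN i; have [pr pi_] := symb_prod_family j (leqnn N).
have aJ : all (pred1 j) (nseq k j) by rewrite all_nseq /= eqxx orbT.
have sk : (size (nseq k j) <= N)%N by rewrite size_nseq.
have := symb_iter pr aJ sk; have := symb_iter pi_ aJ sk.
rewrite size_nseq => si sr; rewrite re_partials im_partials; split.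
- exact: symb_continuous sr i.
- exact: symb_continuous si i.
move=> kN' x; move: si sr; rewrite -(subnSK kN') => -[_ _ di] [_ _ dr].
have jj : pred1 j j by rewrite /= eqxx.
by have [dri _] := dr j jj; have [dii _] := di j jj; split; [exact: dri|exact: dii].
Qed.

(** The [K] factors [scl i] on the left cancel the size [scl i ^- K] of the K-th derivative;
    [scl i ^+ d] is the volume of the supporting cube, by [r <= C0 * rho]. *)
Lemma prodf_fourier_axis j K : (K <= N)%N -> exists2 B : R, 0 <= B & forall i (xi : V),
  (2 * pi * scl i * `|xi 0 j|) ^+ K * cabs (fourier (prodf i) xi) <=
    B * ln (rball i) `^ (- beta) * scl i ^+ d.
Proof.
move=> KN; have [B B0 HB] := prodf_box j KN.
have nn : 0 <= 4 * B * (2 * C1 * C0) ^+ d.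
  by rewrite !mulr_ge0// exprn_ge0// !mulr_ge0// ltW.
exists (4 * B * (2 * C1 * C0) ^+ d) => // i xi.
have s0 := scl_gt0 i; have [r0 _ _ rC0] := subd i.
have C1r : 0 <= C1 * rad i by rewrite mulr_ge0// ltW.
have reg k : (k <= K)%N ->
    [/\ continuous (re (partials (nseq k j) (prodf i))),
        continuous (im (partials (nseq k j) (prodf i))) &
        exists B', (forall x, `|re (partials (nseq k j) (prodf i)) x| <=
                       B' * box (ctr i) (C1 * rad i) x) /\
                  (forall x, `|im (partials (nseq k j) (prodf i)) x| <=
                       B' * box (ctr i) (C1 * rad i) x)].
  move=> kK; have kN := leq_trans kK KN; have [c1 c2 _] := prodf_regular j kN i.
  have [B' _ hB'] := prodf_box j kN; split => //.
  exists (B' * ln (rball i) `^ (- beta) * scl i ^- k).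
  by split => x; have [] := hB' i x.
have der k : (k < K)%N -> forall x,
    derivable (re (partials (nseq k j) (prodf i))) x (e_ j) /\
    derivable (im (partials (nseq k j) (prodf i))) x (e_ j).
  move=> kK; have kN := leq_trans kK KN.
  by have [_ _ +] := prodf_regular j (ltnW kN) i; exact.
have := fourier_decay xi C1r reg der (fun x => (HB i x).1) (fun x => (HB i x).2).
set P := cabs _ => h.
have -> : (2 * pi * scl i * `|xi 0 j|) ^+ K * P =
    scl i ^+ K * ((2 * pi * `|xi 0 j|) ^+ K * P).
  by rewrite [2 * pi * scl i]mulrC -(mulrA (scl i)) exprMn mulrA.
apply: (le_trans (ler_wpM2l (exprn_ge0 K (ltW s0)) h)).
set W := ln _ `^ _; have W0 : 0 <= W by exact: powR_ge0.
have -> : scl i ^+ K * (4 * (B * W * scl i ^- K) * (2 * (C1 * rad i)) ^+ d) =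
    4 * B * W * (2 * (C1 * rad i)) ^+ d.
  by field; rewrite expf_neq0// gt_eqF.
have -> : 4 * B * (2 * C1 * C0) ^+ d * W * scl i ^+ d =
    4 * B * W * (2 * C1 * C0 * scl i) ^+ d by rewrite [X in _ = _ * X]exprMn; ring.
rewrite ler_wpM2l ?mulr_ge0//.
have C1' := ltW C1_gt0; have C0' := ltW C0_gt0; have s0' := ltW s0.
have rC0' : rad i <= C0 * scl i by [].
apply: lerXn2r; [by rewrite nnegrE; nonneg|by rewrite nnegrE; nonneg|].
have := ler_wpM2l C1' rC0'; lra.
Qed.

Lemma prodf_fourier K : (K <= N)%N -> exists2 B : R, 0 <= B & forall i,
  (forall xi : V, cabs (fourier (prodf i) xi) <=
    B * ln (rball i) `^ (- beta) * scl i ^+ d) /\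
  (forall (xi : V) j, (2 * pi * scl i * `|xi 0 j|) ^+ K * cabs (fourier (prodf i) xi) <=
    B * ln (rball i) `^ (- beta) * scl i ^+ d).
Proof.
move=> KN.
(* Exponent 0 gives the bound without decay, along any axis; one exists because [d >= 1]. *)
have [B0 B00 HB0] := prodf_fourier_axis (Ordinal d0) (leq0n N).
have /fin_all_exists[B HB] : forall j : 'I_d, exists B : R, 0 <= B /\ forall i (xi : V),
    (2 * pi * scl i * `|xi 0 j|) ^+ K * cabs (fourier (prodf i) xi) <=
    B * ln (rball i) `^ (- beta) * scl i ^+ d.
  by move=> j; have [B B_ge0 HB] := prodf_fourier_axis j KN; exists B.
have sB : 0 <= \sum_j B j by apply: sumr_ge0 => j _; exact: (HB j).1.
exists (B0 + \sum_j B j); first by rewrite addr_ge0.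
move=> i; have W0 : 0 <= ln (rball i) `^ (- beta) * scl i ^+ d.
  by rewrite mulr_ge0 ?powR_ge0// exprn_ge0// ltW// scl_gt0.
split => [xi|xi j].
  have := HB0 i xi; rewrite expr0 mul1r => h; rewrite (le_trans h)//.
  by rewrite -!mulrA ler_wpM2r// lerDl.
rewrite (le_trans ((HB j).2 i xi))// -!mulrA ler_wpM2r//.
rewrite (bigD1 j)//= addrCA lerDl addr_ge0// sumr_ge0// => l _.
exact: (HB l).1.
Qed.

End family.

Theorem miyachi_msym (R0 beta sigma : R) (N n : nat) (Cnu : {ffun 'I_d -> nat} -> R) :
  Rstar <= R0 -> sigma <= n%:R -> (n + d <= N)%N ->
  miyachi R0 c0 C0 C1 N Cnu gamma beta sigma (@msym R d gamma beta).
Proof.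
move=> R0_ge sn nN.
have [B B0 HB] := @prodf_fourier R0 beta N Cnu R0_ge _ nN.
(* The powers of the logarithm cancel, and so do those of rho with exponent theta. What is left is
   [rho ^ d / |B|], at most [(d / c0) ^ d] by [c0 * rho <= r] and the inscribed cube. *)
exists (Num.sqrt (d%:R `^ sigma * B ^+ 2 * (d%:R / c0) ^+ d)).
move=> c r Psi theta sub ada thI; cbv zeta; set RB := dist0 (eball c r).
pose i : bump_family R0 N Cnu := exist _ (c, r, Psi) (conj sub ada).
have [F1 F2] := HB i.
have s0 : 0 < rho gamma RB by exact: rh_gt0 R0_ge sub.
have l2 : 2 <= ln RB by exact: lnRB_ge2 R0_ge sub.
have [r0 _ cr _] := sub.
have [v -> rv] := vol_eball c d0 r0.
have H := Hdot_norm_le d0 s0 thI sn F1 F2.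
set hd := Hdot_norm _ _ in H *.
have rd0 : 0 < r / d%:R by rewrite divr_gt0 ?ltr0n.
have v0 : 0 < v by rewrite (lt_le_trans _ rv)// exprn_gt0.
rewrite poweR_EFin powRN powR12_sqrt ?(ltW v0)// -EFinM.
apply: (le_trans (lee_wpmul2l _ H)).
  by rewrite lee_fin !mulr_ge0 ?powR_ge0 ?invr_ge0 ?sqrtr_ge0.
rewrite -EFinM lee_fin.
set sg := rho gamma RB in s0 *; set W := ln RB `^ (- beta).
have lW : ln RB `^ beta * W = 1.
  by rewrite /W powRN mulfV// gt_eqF// powR_gt0// (lt_le_trans _ l2).
have thE : sg `^ theta ^+ 2 * sg `^ (- (2 * theta)) = 1.
  rewrite powRN -powR_mulrn ?powR_ge0// -powRrM mulrC [theta * _]mulrC.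
  by rewrite mulVf// gt_eqF// powR_gt0.
have H0 : 0 <= d%:R `^ sigma * (B * W * sg ^+ d) ^+ 2 * sg `^ (- (2 * theta)) / sg ^+ d.
  by nonneg.
have A0 : 0 <= ln RB `^ beta * sg `^ theta by nonneg.
rewrite -[ln RB `^ beta * sg `^ theta](ger0_norm A0) -sqrtr_sqr -sqrtrV ?(ltW v0)//.
rewrite -sqrtrM ?sqr_ge0// -sqrtrM; last by nonneg.
apply: ler_wsqrtr.
have -> : (ln RB `^ beta * sg `^ theta) ^+ 2 * v^-1 *
    (d%:R `^ sigma * (B * W * sg ^+ d) ^+ 2 * sg `^ (- (2 * theta)) / sg ^+ d) =
    (ln RB `^ beta * W) ^+ 2 * (sg `^ theta ^+ 2 * sg `^ (- (2 * theta))) *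
    (d%:R `^ sigma * B ^+ 2) * (sg ^+ d / v).
  by field; rewrite (gt_eqF v0) expf_neq0// gt_eqF.
rewrite lW thE expr1n !mul1r ler_wpM2l//; first by nonneg.
rewrite ler_pdivrMr//; apply: (le_trans _ (ler_wpM2l _ rv)); last first.
  by rewrite exprn_ge0// divr_ge0// ltW.
rewrite -exprMn lerXn2r ?nnegrE ?(ltW s0)//.
  by rewrite mulr_ge0 ?divr_ge0 ?(ltW r0) ?(ltW c0_gt0).
have -> : d%:R / c0 * (r / d%:R) = r / c0.
  by field; rewrite (gt_eqF c0_gt0) pnatr_eq0 -lt0n d0.
by rewrite ler_pdivlMr// mulrC.
Qed.

End miyachi_condition.

Theorem proposition6p1 (R : realType) (d : nat) (gamma : R)
    (hd : (1 <= d)%N) (hgamma : 1 < gamma) :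
  (forall beta : R,
     smooth (@msym R d gamma beta) /\
     forall nu : {ffun 'I_d -> nat}, exists C : R,
     forall R0 : R, expR 2 <= R0 ->
     forall xi : 'rV[R]_d, R0 <= enorm xi ->
       cabs (mderiv nu (@msym R d gamma beta) xi) <=
         C * ln (enorm xi) `^ (- beta) *
           (ln (enorm xi) `^ (gamma - 1) / enorm xi) ^+ mlen nu)
  /\
  (exists N0 : R -> nat,
   forall c0 C0 C1 : R, 0 < c0 -> c0 < C0 -> 0 < C1 ->
   exists Rstar : R, expR 2 <= Rstar /\
   forall R0 : R, Rstar <= R0 ->
   forall beta sigma : R, d%:R / 2 < sigma ->
   forall N : nat, (N0 sigma <= N)%N ->
   forall Cnu : {ffun 'I_d -> nat} -> R,
     miyachi R0 c0 C0 C1 N Cnu gamma beta sigma (@msym R d gamma beta)).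
Proof.
split=> [beta|].
  split=> [|nu]; first exact: smooth_msym.
  have [C HC] := msym_bound hgamma beta nu.
  by exists C => R0 eR0 xi R0xi; apply: HC; exact: le_trans eR0 R0xi.
(* Here n is the integer part of sigma plus 1, hence at least sigma, and n + d is the number of
   integrations by parts. *)
exists (fun sigma => ((Num.truncn sigma).+1 + d)%N) => c0 C0 C1 c0_gt0 c0C0 C1_gt0.
exists (Rstar gamma C0 C1); split; first exact: Rstar_ge.
move=> R0 R0_ge beta sigma _ N NN Cnu.
apply: (@miyachi_msym _ _ _ _ _ _ hd hgamma c0_gt0 c0C0 C1_gt0
  _ _ _ _ (Num.truncn sigma).+1) => //.
by rewrite ltW// truncnS_gt.
Qed.
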